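(* Among constant potentials $U$ in the probability cone, the isotropy group is one-dimensional except at the threshold $U\equiv2\pi^{2}$, where its dimension is two. At $U\equiv2\pi^{2}$ the formal isotropy algebra is $$\ker\big(\partial^{3}+4\pi^{2}\partial\big)\cap\{\xi(0)=\xi(1)=0\}=\operatorname{span}\Big\{\frac{\sin(2\pi z)}{2\pi},\ \frac{1-\cos(2\pi z)}{2\pi}\Big\},$$ which is precisely the span of the drift fields of the canonical flow and the quarter-phase flow; both fields are complete, so the entire formal symmetry integrates. In the uniformizing coordinate $V=\tan(\pi(z-\tfrac12))$ these two flows (canonical and quarter-phase) are the dilations $\dot V=V$ and the translations $\dot V=1$, so the isotropy group is the (increasing) affine group of the line, realized inside the distortion group by conjugation with any Cauchy reference law, i.e. as $\{F_{f}\circ M\circ Q_{f}: M\text{ increasing affine}\}$ for $f$ any Cauchy density. No law in $\mathcal{D}_{+}^{2}$ has isotropy group of dimension three or more.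
   Context: $\mathcal{D}_{+}^{2}$ is the set of probability densities on $\mathbb{R}$ that are strictly positive and $C^{2}$ on an open interval (the support) and vanish outside it. $F_{f}$ is the distribution function, $Q_{f}=F_{f}^{-1}$ on $(0,1)$; $\{G,z\}=\frac{G'''}{G'}-\frac32(\frac{G''}{G'})^{2}$ is the Schwarzian derivative; $U_{f}=\{Q_{f},\cdot\}$ is the rank Hill potential of $f$. The probability cone is the set of $U\in C^{0}(0,1)$ for which $\psi''+\tfrac12U\psi=0$ has a positive solution on $(0,1)$; equivalently, the set of potentials $U_{f}$, $f\in\mathcal{D}_{+}^{2}$ (the constant $2a^{2}$, $a>0$, lies in it iff $a\le\pi$, and all constants $\le0$ lie in it). Distortions are increasing bijections of $[0,1]$; here those that are $C^{3}$-diffeomorphisms of $(0,1)$. They act on potentials by $\mathrm{Ad}^{*}_{A}U=(U\circ B)(B')^{2}+\{B,\cdot\}$, $B=A^{-1}$. The isotropy group of $U$ is $\{A:\mathrm{Ad}^{*}_{A}U=U\}$; for $U=U_{f}$ with $f$ of support $I$ it equals $\{F_{f}\circ M\circ Q_{f}: M\text{ an increasing Möbius self-map of }I\}$; the isotropy group of a law $f$ is that of $U_{f}$; dimension means Lie group dimension. The formal isotropy algebra of $U$ is the space of vector fields $\xi$ on $(0,1)$ with $\xi'''+2U\xi'+U'\xi=0$ that vanish at both endpoints $0,1$; a field is complete if its flow exists for all time on $(0,1)$, fixing the endpoints. The drift field of the flow $\partial_{t}f=(v(F)-1)f$ of a kernel $v$ is $\xi_{v}(z)=\int_{0}^{z}v-z$;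 the canonical flow has $v(z)=2\sin^{2}(\pi z)$ and the quarter-phase flow has $v(z)=2\sin^{2}(\pi(z+\tfrac14))$. Cauchy densities are $\frac{\gamma}{\pi[(x-m)^{2}+\gamma^{2}]}$. *)

(* Defs.v *)
(* MathComp-Analysis, over an arbitrary [R : realType]. *)
From HB Require Import structures.
From mathcomp Require Export all_boot all_order all_algebra.
From mathcomp Require Export all_classical all_reals all_analysis.

Set Implicit Arguments.
Unset Strict Implicit.
Unset Printing Implicit Defensive.

Export Order.TTheory GRing.Theory Num.Theory.
Export numFieldNormedType.Exports.

Local Open Scope classical_set_scope.
Local Open Scope ring_scope.

(** ** One-variable calculus *)

(* [derive1n k f] is total; these two predicates carry the differentiability
   side conditions. [I] is meant to be open. *)
Definition derivable_n {R : realType} (n : nat) (I : set R) (f : R -> R) : Prop :=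
  forall (k : nat) (x : R), (k < n)%N -> I x -> derivable (derive1n k f) x 1.

Definition Cn_on {R : realType} (n : nat) (I : set R) (f : R -> R) : Prop :=
  derivable_n n I f /\ forall x, I x -> {for x, continuous (derive1n n f)}.

Definition schwarzian {R : realType} (G : R -> R) (z : R) : R :=
  derive1n 3 G z / derive1n 1 G z
  - 3 / 2 * (derive1n 2 G z / derive1n 1 G z) ^+ 2.

(** ** Laws *)

Definition law_supp {R : realType} (f : R -> R) : set R := [set x | 0 < f x].

Record law2 {R : realType} (f : R -> R) : Prop := Law2 {
  law2_ge0 : forall x, 0 <= f x;
  law2_open : open (law_supp f);
  law2_itv : is_interval (law_supp f);
  law2_C2 : Cn_on 2 (law_supp f) f;
  law2_int1 : (\int[@lebesgue_measure R]_x (f x)%:E = 1)%E }.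

Definition law_cdf {R : realType} (f : R -> R) (x : R) : R :=
  \int[@lebesgue_measure R]_(t in `]-oo, x]) f t.

(* The inverse of [law_cdf f : law_supp f -> ]0, 1[]; the value outside of
   ]0, 1[ is junk. *)
Definition law_quantile {R : realType} (f : R -> R) : R -> R :=
  'pinv_(fun=> 0) (law_supp f) (law_cdf f).

Definition law_hill {R : realType} (f : R -> R) : R -> R :=
  schwarzian (law_quantile f).

Definition cauchy_density {R : realType} (m g x : R) : R :=
  g / (pi * ((x - m) ^+ 2 + g ^+ 2)).

(** ** Potentials, distortions, isotropy groups

    A potential is a function [R -> R] of which only the values on ]0, 1[
    matter. *)

Definition prob_cone {R : realType} (U : R -> R) : Prop :=
  (forall z, z \in `]0, 1[ -> {for z, continuous U}) /\
  exists psi : R -> R, derivable_n 2 `]0, 1[ psi /\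
    forall z, z \in `]0, 1[ ->
      0 < psi z /\ derive1n 2 psi z + 1 / 2 * U z * psi z = 0.

(* The distortions of [0, 1] are extended to R by the identity, so that they
   form a group for [\o] and are equal iff they agree on [0, 1]. *)
Definition dist_inv {R : realType} (A : R -> R) : R -> R := 'pinv_id `[0, 1] A.

Record distortion {R : realType} (A : R -> R) : Prop := Distortion {
  distortion_out : forall z, z \notin `[0, 1] -> A z = z;
  distortion_bij : set_bij `[0, 1] `[0, 1] A;
  distortion_incr : {in `[0, 1] &, {mono A : x y / x <= y}};
  distortion_C3 : Cn_on 3 `]0, 1[ A;
  distortion_inv_C3 : Cn_on 3 `]0, 1[ (dist_inv A) }.

Definition Ad_star {R : realType} (A U : R -> R) (z : R) : R :=
  let B := dist_inv A in U (B z) * derive1 B z ^+ 2 + schwarzian B z.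

Definition isotropy {R : realType} (U : R -> R) : set (R -> R) :=
  [set A | distortion A /\ forall z, z \in `]0, 1[ -> Ad_star A U z = U z].

(* F_f o M o Q_f, as a distortion (the endpoints are fixed). *)
Definition conj_law {R : realType} (f M : R -> R) (z : R) : R :=
  if z \in `]0, 1[ then law_cdf f (M (law_quantile f z)) else z.

Definition incr_affine {R : realType} : set (R -> R) :=
  [set M | exists a b : R, 0 < a /\ M = (fun x => a * x + b)].

(** ** Vector fields on ]0, 1[

    A field is a function [R -> R] of which only the values on ]0, 1[ matter;
    to vanish at an endpoint is to tend to 0 there. *)

Definition vanish_ends {R : realType} (xi : R -> R) : Prop :=
  xi z @[z --> 0^'+] --> (0 : R) /\ xi z @[z --> 1^'-] --> (0 : R).

(* Meant for [U] differentiable on ]0, 1[. *)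
Definition formal_isotropy {R : realType} (U : R -> R) : set (R -> R) :=
  [set xi | [/\ derivable_n 3 `]0, 1[ xi,
      forall z, z \in `]0, 1[ ->
        derive1n 3 xi z + 2 * U z * derive1 xi z + derive1 U z * xi z = 0
    & vanish_ends xi]].

Definition field_span {R : realType} (xi1 xi2 : R -> R) : set (R -> R) :=
  [set xi | exists a b : R, forall z, z \in `]0, 1[ -> xi z = a * xi1 z + b * xi2 z].

Record is_flow {R : realType} (xi : R -> R) (phi : R -> R -> R) : Prop := IsFlow {
  flow_0 : forall z, z \in `]0, 1[ -> phi 0 z = z;
  flow_D : forall s t z, z \in `]0, 1[ -> phi (s + t) z = phi s (phi t z);
  flow_in : forall t z, z \in `]0, 1[ -> phi t z \in `]0, 1[;
  flow_ode : forall t z, z \in `]0, 1[ ->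
    is_derive t (1 : R) (fun s => phi s z) (xi (phi t z));
  flow_fix0 : forall t, phi t 0 = 0;
  flow_fix1 : forall t, phi t 1 = 1;
  flow_continuous : forall t, {within `[0, 1], continuous (phi t)} }.

Definition complete_field {R : realType} (xi : R -> R) : Prop :=
  exists phi, is_flow xi phi.

Definition drift {R : realType} (v : R -> R) (z : R) : R :=
  \int[@lebesgue_measure R]_(s in `[0, z]) v s - z.

Definition canonical_kernel {R : realType} (z : R) : R :=
  2 * sin (pi * z) ^+ 2.

Definition quarter_kernel {R : realType} (z : R) : R :=
  2 * sin (pi * (z + 1 / 4)) ^+ 2.

Definition unif_coord {R : realType} (z : R) : R := tan (pi * (z - 1 / 2)).

(** ** Lie group dimension *)

Definition partial {R : realType} {d : nat} (j : 'I_d) (g : 'rV[R]_d -> R)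
    (p : 'rV[R]_d) : R :=
  derive1 (fun t : R => g (p + t *: delta_mx 0 j)) 0.

Fixpoint Ck {R : realType} {d : nat} (k : nat) (W : set 'rV[R]_d)
    (g : 'rV[R]_d -> R) : Prop :=
  (forall p, W p -> {for p, continuous g}) /\
  if k is k'.+1 then
    forall j : 'I_d,
      (forall p, W p -> derivable (fun t : R => g (p + t *: delta_mx 0 j)) 0 1)
      /\ Ck k' W (partial j g)
  else True.

Definition smooth {R : realType} {d e : nat} (W : set 'rV[R]_d)
    (g : 'rV[R]_d -> 'rV[R]_e) : Prop :=
  forall (k : nat) (j : 'I_e), Ck k W (fun p => g p 0 j).

(* A group [G] of distortions is a Lie group of dimension [d]: for the topology
   of pointwise convergence (which, on increasing bijections of [0, 1], is that
   of uniform convergence) it has an atlas of charts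
   [lie_coord i : lie_par i @` lie_dom i -> lie_dom i] onto open sets of R^d,
   with C^oo transition maps, C^oo product and C^oo inverse, and acts
   differentiably on ]0, 1[ with linearly independent infinitesimal generators.
   The topology and the independence clause rule out exotic structures of
   another dimension on the abstract group [G]. The evaluation maps are only
   asked to be C^1, since distortions have finite regularity. *)
Record lie_atlas {R : realType} (G : set (R -> R)) (d : nat) (I : Type)
    (dom : I -> set 'rV[R]_d) (par : I -> 'rV[R]_d -> R -> R)
    (coord : I -> (R -> R) -> 'rV[R]_d) : Prop := LieAtlas {
  lie_dist : forall A, G A -> distortion A;
  lie_id : G id;
  lie_comp : forall A B, G A -> G B -> G (A \o B);
  lie_inv : forall A, G A -> G (dist_inv A);
  lie_dom_open : forall i, open (dom i);
  lie_cover : G = \bigcup_i (par i @` dom i);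
  lie_open : forall i,
    exists2 O : set {ptws R -> R}, open O & par i @` dom i = G `&` O;
  lie_parK : forall i p, dom i p -> coord i (par i p) = p;
  lie_par_cont : forall i p, dom i p ->
    {for p, continuous (par i : 'rV[R]_d -> {ptws R -> R})};
  lie_coord_cont : forall i,
    {within (par i @` dom i : set {ptws R -> R}),
      continuous (coord i : {ptws R -> R} -> 'rV[R]_d)};
  lie_transition : forall i j,
    smooth [set p | dom i p /\ (par j @` dom j) (par i p)]
           (fun p => coord j (par i p));
  lie_smooth_comp : forall i j k,
    smooth [set p : 'rV[R]_(d + d) | [/\ dom i (lsubmx p), dom j (rsubmx p)
              & (par k @` dom k) (par i (lsubmx p) \o par j (rsubmx p))]]
           (fun p => coord k (par i (lsubmx p) \o par j (rsubmx p)));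
  lie_smooth_inv : forall i j,
    smooth [set p | dom i p /\ (par j @` dom j) (dist_inv (par i p))]
           (fun p => coord j (dist_inv (par i p)));
  lie_eval_C1 : forall i z, z \in `]0, 1[ -> Ck 1 (dom i) (fun p => par i p z);
  lie_eval_free : forall i p (c : 'rV[R]_d), dom i p ->
    (forall z, z \in `]0, 1[ ->
       \sum_(j < d) c 0 j * partial j (fun q => par i q z) p = 0) ->
    c = 0 }.

Definition has_lie_dim {R : realType} (G : set (R -> R)) (d : nat) : Prop :=
  exists (I : Type) (dom : I -> set 'rV[R]_d) (par : I -> 'rV[R]_d -> R -> R)
    (coord : I -> (R -> R) -> 'rV[R]_d), lie_atlas G dom par coord.

(* Main.v *)
Require Import Defs.
From mathcomp Require Import ring lra.

(** Why the theorem is true.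

    Everything is read off one change of variable.  Let [G] be an increasing
    C^3 function on ]0, 1[ with Schwarzian derivative [U] and limit -oo at 0:
    a uniformizer of [U].  By the chain rule, the coadjoint image of [U] under
    [A] is the Schwarzian derivative of [G \o A^-1]; so [A] fixes [U] exactly
    when [G \o A^-1] and [G] have the same Schwarzian derivative, that is, when
    they differ by a Moebius map ([mobius_rigidity]).  As [A] fixes the endpoint
    0, both tend to -oo there, hence the Moebius map fixes the point at
    infinity: it is affine ([affine_rigidity], [isotropy_affine]).  When [G]
    maps ]0, 1[ onto [J], the isotropy group of [U] is thus the group of the
    increasing affine maps that preserve [J], transported by [G] ([isotropyP]).

    Constant potentials.  A potential [2 k] has the uniformizers [- r / s], with
    [r] and [s] two solutions of [y'' + k y = 0] with positive Wronskian and
    [s 0 = 0] ([ratio_uniformizer]).  Sturm comparison excludes [k > pi ^ 2] from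
    the cone ([prob_cone_cst_le]).  If [k < pi ^ 2] then [s] does not vanish at 1
    and, with [r z = s (1 - z)], the range is the negative half-line, which only
    dilations preserve: dimension 1.  If [k = pi ^ 2], the quotient
    [- cos (pi z) / sin (pi z)] is the coordinate [V = tan (pi (z - 1 / 2))], onto
    the whole line, which all increasing affine maps preserve: dimension 2.  The
    logarithm of the slope, with the translation length in the second case, is
    one global chart ([isotropy_lie_dim]).

    No dimension above 2.  The quantile function [Q] of a law has the rank Hill
    potential as its Schwarzian derivative, and either [Q] or [-1 / (Q - inf)] is
    a uniformizer ([law_uniformizer]).  An affine map is determined by its values
    at two points, so every [G (A z)] is a fixed linear combination of
    [G (A z1)] and [G (A z2)]; differentiating along a chart, the generators
    evaluated at [z] depend linearly on their values at [z1] and [z2] only, and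
    three of them are linearly dependent ([no_lie_dim3]).

    The threshold.  There the equation of the formal algebra says that [xi'] is
    a harmonic oscillator of frequency [2 pi]; three first integrals determine
    [xi], and the condition at 0 removes the constant
    ([critical_formal_span]).  The two drift fields are its basis up to sign.  In
    the coordinate [V] the field [al * xi_can + be * xi_quarter] reads
    [V' = al * V + be], whose flow is affine, hence complete and inside the
    isotropy group ([affine_flow]).  Finally the distribution function of a
    Cauchy law is the inverse of [V] up to an affine change of variable
    ([unif_coord_cauchy_cdf]), so that conjugation by any Cauchy law gives the
    same group of affine maps ([conj_cauchy]). *)

Set Implicit Arguments.
Unset Strict Implicit.
Unset Printing Implicit Defensive.

Local Open Scope classical_set_scope.
Local Open Scope ring_scope.

(** * Calculus of C^n functions on open sets *)

Section calculus.
Context {R : realType}.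
Implicit Types (f g : R -> R) (x y z a b : R) (I J : set R).

(** Pointwise forms of the rules of derivation, which compose as proof terms when
    the function is an explicit lambda-expression. *)
Lemma derD f g x a b : is_derive x 1 f a -> is_derive x 1 g b ->
  is_derive x 1 (fun y => f y + g y) (a + b).
Proof. by move=> df dg; exact: (is_deriveD df dg). Qed.

Lemma derN f x a : is_derive x 1 f a -> is_derive x 1 (fun y => - f y) (- a).
Proof. by move=> df; exact: (is_deriveN df). Qed.

Lemma derB f g x a b : is_derive x 1 f a -> is_derive x 1 g b ->
  is_derive x 1 (fun y => f y - g y) (a - b).
Proof. by move=> df dg; exact: (is_deriveB df dg). Qed.

Lemma derM f g x a b : is_derive x 1 f a -> is_derive x 1 g b ->
  is_derive x 1 (fun y => f y * g y) (a * g x + f x * b).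
Proof.
move=> df dg; have := is_deriveM df dg.
by rewrite /GRing.scale /= addrC [g x * a]mulrC.
Qed.

Lemma derV f x a : f x != 0 -> is_derive x 1 f a ->
  is_derive x 1 (fun y => (f y)^-1) (- a / f x ^+ 2).
Proof.
move=> fx df; have := is_deriveV fx df.
by rewrite /GRing.scale /= mulrC mulrN mulNr.
Qed.

Lemma derX2 f x a : is_derive x 1 f a ->
  is_derive x 1 (fun y => f y ^+ 2) (2 * f x * a).
Proof.
move=> df; refine (is_derive_eq (derM df df : is_derive x 1 (fun y => f y ^+ 2) _) _).
by ring.
Qed.

Lemma derC (c : R) x : is_derive x 1 (fun _ => c) 0.
Proof. exact: is_derive_cst. Qed.

Lemma derI x : is_derive x 1 (fun y : R => y) 1.
Proof. exact: is_derive_id. Qed.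

Lemma der_comp f g x a b : is_derive (g x) 1 f a -> is_derive x 1 g b ->
  is_derive x 1 (fun y => f (g y)) (a * b).
Proof. by move=> df dg; exact: (is_derive1_comp df dg). Qed.

Lemma der_derive1 f x a : is_derive x 1 f a -> derive1 f x = a.
Proof. by move=> df; rewrite derive1E derive_val. Qed.

Lemma der_ex f x : derivable f x 1 -> is_derive x 1 f (derive1 f x).
Proof. by rewrite derive1E => /derivableP. Qed.

Lemma der_continuous f x a : is_derive x 1 f a -> {for x, continuous f}.
Proof. by case=> /derivable1_diffP/differentiable_continuous. Qed.

Lemma open_oo (a b : R) : open `]a, b[%classic.
Proof. exact: interval_open. Qed.

Lemma open_near I (P : R -> Prop) x : open I -> I x -> (forall y, I y -> P y) ->
  \forall y \near x, P y.
Proof.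
by move=> oI Ix IP; apply: filterS IP _; exact: open_nbhs_nbhs.
Qed.

Lemma der_eq_on I f g x a : open I -> I x -> (forall y, I y -> f y = g y) ->
  is_derive x 1 f a -> is_derive x 1 g a.
Proof. by move=> oI Ix fg; apply: near_eq_is_derive; exact: open_near oI Ix fg. Qed.

Lemma derive1_eq_on I f g x : open I -> I x -> (forall y, I y -> f y = g y) ->
  derive1 f x = derive1 g x.
Proof.
move=> oI Ix fg; rewrite !derive1E; apply: near_eq_derive.
exact: open_near oI Ix fg.
Qed.

Lemma derive1n_eq_on I f g (k : nat) x :
  open I -> I x -> (forall y, I y -> f y = g y) ->
  derive1n k f x = derive1n k g x.
Proof.
move=> oI + fg; elim: k x => [|k IH] x Ix; first exact: fg.
by rewrite !derive1nS; exact: derive1_eq_on oI Ix IH.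
Qed.

Lemma derive1Sn f (k : nat) : derive1n k.+1 f = derive1n k (derive1 f).
Proof. exact: iterSr. Qed.

Lemma Cn_on0 I f : Cn_on 0 I f <-> forall x, I x -> {for x, continuous f}.
Proof. by split=> [[]|] // h; split. Qed.

(** The recursion on the derivative, from which every closure property of C^n
    functions follows by induction on [n]. *)
Lemma Cn_onS (n : nat) I f : Cn_on n.+1 I f <->
  (forall x, I x -> is_derive x 1 f (derive1 f x)) /\ Cn_on n I (derive1 f).
Proof.
split=> [[df cf]|[df [ddf cf]]]; split.
- by move=> x Ix; apply: der_ex; exact: (df 0%N).
- split=> [k x kn Ix|]; rewrite -?derive1Sn; first exact: (df k.+1).
  exact: cf.
- move=> [|k] x kn Ix; first by case: (df x Ix).
  by rewrite derive1Sn; exact: ddf.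
- by move=> x; rewrite derive1Sn; exact: cf.
Qed.

Lemma Cn_on_eq (n : nat) I f g : open I -> (forall x, I x -> f x = g x) ->
  Cn_on n I f -> Cn_on n I g.
Proof.
move=> oI; elim: n f g => [|n IH] f g fg.
  rewrite !Cn_on0 => cf x Ix; rewrite /prop_for /continuous_at -fg//.
  apply: cvg_trans (cf x Ix); apply: near_eq_cvg.
  exact: open_near oI Ix fg.
rewrite !Cn_onS => -[df cf]; split.
  move=> x Ix; rewrite -(derive1_eq_on oI Ix fg).
  exact: der_eq_on oI Ix fg (df x Ix).
by apply: IH cf => x Ix; exact: derive1_eq_on oI Ix fg.
Qed.

Lemma Cn_onS_der (n : nat) I f (df : R -> R) : open I ->
  (forall x, I x -> is_derive x 1 f (df x)) -> Cn_on n I df -> Cn_on n.+1 I f.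
Proof.
move=> oI fdf cdf; apply/Cn_onS; split=> [x Ix|].
  by rewrite (der_derive1 (fdf x Ix)); exact: fdf.
by apply: Cn_on_eq cdf => // x Ix; rewrite (der_derive1 (fdf x Ix)).
Qed.

Lemma Cn_onW (n : nat) I f : Cn_on n.+1 I f -> Cn_on n I f.
Proof.
elim: n f => [|n IH] f.
  by move=> /Cn_onS[df _]; apply/Cn_on0 => x /df; exact: der_continuous.
by move=> /Cn_onS[df /IH cf]; apply/Cn_onS.
Qed.

Lemma Cn_on_le (m n : nat) I f : (m <= n)%N -> Cn_on n I f -> Cn_on m I f.
Proof.
move=> /subnK <-; elim: (n - m)%N => // k IH.
by rewrite addSn => /Cn_onW; exact: IH.
Qed.

Lemma Cn_on_cst (n : nat) I (c : R) : open I -> Cn_on n I (fun=> c).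
Proof.
move=> oI; elim: n c => [|n IH] c; first by apply/Cn_on0 => x _; exact: cvg_cst.
by apply: (Cn_onS_der oI) (IH 0) => x _; exact: derC.
Qed.

Lemma Cn_onD (n : nat) I f g : open I -> Cn_on n I f -> Cn_on n I g ->
  Cn_on n I (fun x => f x + g x).
Proof.
move=> oI; elim: n f g => [|n IH] f g.
  by rewrite !Cn_on0 => cf cg x Ix; apply: cvgD; [exact: cf|exact: cg].
move=> /Cn_onS[df cf] /Cn_onS[dg cg]; apply: (Cn_onS_der oI) (IH _ _ cf cg).
by move=> x Ix; apply: derD; [exact: df|exact: dg].
Qed.

Lemma Cn_onM (n : nat) I f g : open I -> Cn_on n I f -> Cn_on n I g ->
  Cn_on n I (fun x => f x * g x).
Proof.
move=> oI; elim: n f g => [|n IH] f g.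
  by rewrite !Cn_on0 => cf cg x Ix; apply: cvgM; [exact: cf|exact: cg].
move=> cf' cg'; have /Cn_onW cf0 := cf'; have /Cn_onW cg0 := cg'.
move: cf' cg' => /Cn_onS[df cf] /Cn_onS[dg cg].
apply: (Cn_onS_der oI) (Cn_onD oI (IH _ _ cf cg0) (IH _ _ cf0 cg)).
by move=> x Ix; apply: derM; [exact: df|exact: dg].
Qed.

Lemma Cn_onN (n : nat) I f : open I -> Cn_on n I f -> Cn_on n I (fun x => - f x).
Proof.
move=> oI cf; apply: Cn_on_eq (Cn_onM oI (Cn_on_cst n (-1) oI) cf) => // x _.
by rewrite mulN1r.
Qed.

Lemma Cn_onV (n : nat) I f : open I -> (forall x, I x -> f x != 0) ->
  Cn_on n I f -> Cn_on n I (fun x => (f x)^-1).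
Proof.
move=> oI f0; elim: n f f0 => [|n IH] f f0.
  by rewrite !Cn_on0 => cf x Ix; apply: cvgV; [exact: f0|exact: cf].
move=> cf'; have /Cn_onW cf0 := cf'.
move: cf' => /Cn_onS[df cf].
have cV := IH _ f0 cf0.
apply: (Cn_onS_der oI) (Cn_onM oI (Cn_onN oI cf) (Cn_onM oI cV cV)).
move=> x Ix; apply: is_derive_eq; first exact: derV (f0 x Ix) (df x Ix).
by rewrite expr2 invfM.
Qed.

Lemma Cn_on_comp (n : nat) I J f g : open I -> open J ->
  (forall x, I x -> J (g x)) -> Cn_on n J f -> Cn_on n I g ->
  Cn_on n I (fun x => f (g x)).
Proof.
move=> oI oJ gIJ; elim: n f g gIJ => [|n IH] f g gIJ.
  rewrite !Cn_on0 => cf cg x Ix.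
  by apply: (@continuous_comp _ _ _ g f); [exact: cg|apply: cf; exact: gIJ].
move=> cf' cg'; have /Cn_onW cg0 := cg'.
move: cf' cg' => /Cn_onS[df cf] /Cn_onS[dg cg].
apply: (Cn_onS_der oI) (Cn_onM oI (IH _ _ gIJ cf cg0) cg).
by move=> x Ix; apply: der_comp; [apply: df; exact: gIJ|exact: dg].
Qed.

(** The formula [g' = 1 / f'(g)] raises the regularity of [g] by one at each
    step of the induction. *)
Lemma Cn_on_inverse (n : nat) I J f g : open I -> open J ->
  (forall y, J y -> I (g y)) -> (forall y, J y -> f (g y) = y) ->
  (forall x, I x -> derive1 f x != 0) ->
  (forall y, J y -> derivable g y 1) ->
  Cn_on n.+1 I f -> Cn_on n.+1 J g.
Proof.
move=> oI oJ gI fgK f0 dg /Cn_onS[df cf].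
have g' y : J y -> derive1 g y = (derive1 f (g y))^-1.
  move=> Jy; have := der_comp (df _ (gI y Jy)) (der_ex (dg y Jy)).
  move=> /(der_eq_on oJ Jy fgK)/der_derive1.
  rewrite (der_derive1 (derI y)) => h.
  apply: (mulfI (f0 _ (gI y Jy))); rewrite -h.
  by rewrite mulfV// f0//; exact: gI.
have dg' y : J y -> is_derive y 1 g (derive1 f (g y))^-1.
  by move=> Jy; rewrite -g'//; apply: der_ex; exact: dg.
elim: n cf => [|n IH] cf; apply: (Cn_onS_der oJ dg'); apply: Cn_onV => //.
- by move=> y Jy; apply: f0; exact: gI.
- rewrite Cn_on0 in cf; apply/Cn_on0 => y Jy.
  apply: (@continuous_comp _ _ _ g (derive1 f)); last exact: cf (gI y Jy).
  exact: der_continuous (dg' y Jy).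
- by move=> y Jy; apply: f0; exact: gI.
- by apply: (Cn_on_comp oJ oI gI cf); apply: IH; exact: Cn_onW.
Qed.

(** * The Schwarzian derivative *)

(** Explicit derivatives up to order three: iterated derivatives are only ever
    computed through such a triple. *)
Definition jet3 I f (f1 f2 f3 : R -> R) := forall x, I x ->
  [/\ is_derive x 1 f (f1 x), is_derive x 1 f1 (f2 x) & is_derive x 1 f2 (f3 x)].

Lemma jet3E I f f1 f2 f3 x : open I -> jet3 I f f1 f2 f3 -> I x ->
  [/\ derive1n 1 f x = f1 x, derive1n 2 f x = f2 x & derive1n 3 f x = f3 x].
Proof.
move=> oI jf.
have e1 y : I y -> derive1n 1 f y = f1 y.
  by move=> /jf[h _ _]; rewrite derive1n1; exact: der_derive1.
have e2 y : I y -> derive1n 2 f y = f2 y.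
  move=> Iy; have [_ h _] := jf y Iy; rewrite derive1nS -(der_derive1 h).
  exact: derive1_eq_on oI Iy e1.
move=> Ix; split; [exact: e1|exact: e2|].
have [_ _ h] := jf x Ix; rewrite derive1nS -(der_derive1 h).
exact: derive1_eq_on oI Ix e2.
Qed.

Lemma derivable_n_jet3 I f : derivable_n 3 I f ->
  jet3 I f (derive1n 1 f) (derive1n 2 f) (derive1n 3 f).
Proof.
move=> df x Ix; split; last 2 first.
- by rewrite [derive1n 2 f]derive1nS; apply: der_ex; exact: (df 1%N).
- by rewrite [derive1n 3 f]derive1nS; apply: der_ex; exact: (df 2%N).
- by rewrite derive1n1; apply: der_ex; exact: (df 0%N).
Qed.

Lemma jet3_derivable_n I f f1 f2 f3 : open I -> jet3 I f f1 f2 f3 ->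
  derivable_n 3 I f.
Proof.
move=> oI jf k x k3 Ix; have [h1 h2 h3] := jf x Ix.
have e y := jet3E oI jf (x := y).
case: k k3 => [|[|[|//]]] _.
- by case: h1.
- by case: (@der_eq_on I f1 (derive1n 1 f) x _ oI Ix _ h2) => // y /e[].
- by case: (@der_eq_on I f2 (derive1n 2 f) x _ oI Ix _ h3) => // y /e[].
Qed.

Lemma schwarzian_jet3 I f f1 f2 f3 x : open I -> jet3 I f f1 f2 f3 -> I x ->
  schwarzian f x = f3 x / f1 x - 3 / 2 * (f2 x / f1 x) ^+ 2.
Proof. by move=> oI jf Ix; rewrite /schwarzian; case: (jet3E oI jf Ix) => -> -> ->. Qed.

Lemma schwarzian_eq_on I f g x : open I -> I x -> (forall y, I y -> f y = g y) ->
  schwarzian f x = schwarzian g x.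
Proof. by move=> oI Ix fg; rewrite /schwarzian !(derive1n_eq_on _ oI Ix fg). Qed.

(** The cocycle identity, from the derivatives of order at most three of a
    composite. *)
Lemma schwarzian_comp I J f g x : open I -> open J ->
  (forall y, I y -> J (g y)) -> derivable_n 3 J f -> derivable_n 3 I g ->
  I x -> derive1 f (g x) != 0 -> derive1 g x != 0 ->
  schwarzian (fun y => f (g y)) x =
  schwarzian f (g x) * derive1 g x ^+ 2 + schwarzian g x.
Proof.
move=> oI oJ gIJ /derivable_n_jet3 jf /derivable_n_jet3 jg Ix f0 g0.
pose f1 : R -> R := derive1n 1 f; pose f2 : R -> R := derive1n 2 f.
pose f3 : R -> R := derive1n 3 f; pose g1 : R -> R := derive1n 1 g.
pose g2 : R -> R := derive1n 2 g; pose g3 : R -> R := derive1n 3 g.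
rewrite (@schwarzian_jet3 I _ (fun y => f1 (g y) * g1 y)
  (fun y => f2 (g y) * g1 y * g1 y + f1 (g y) * g2 y)
  (fun y => f3 (g y) * g1 y * g1 y * g1 y + 3 * (f2 (g y) * g1 y * g2 y)
     + f1 (g y) * g3 y))//; last first.
  move=> y Iy; have [df1 df2 df3] := jf _ (gIJ y Iy).
  have [dg1 dg2 dg3] := jg y Iy; split.
  - exact: der_comp.
  - by apply: derM => //; exact: der_comp.
  - refine (is_derive_eq (derD (derM (derM (der_comp df3 dg1) dg2) dg2)
      (derM (der_comp df2 dg1) dg3)) _).
    by rewrite -/f1 -/f2 -/f3 -/g1 -/g2 -/g3; ring.
rewrite /schwarzian -derive1n1 -/f1 -/f2 -/f3 -/g1 -/g2 -/g3.
have {}f0 : f1 (g x) != 0 by [].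
have {}g0 : g1 x != 0 by [].
by field; rewrite f0 g0.
Qed.

(** * Constancy and monotonicity *)

Lemma der0_cst (a b : R) f : (forall x, x \in `]a, b[ -> is_derive x 1 f 0) ->
  forall x y, x \in `]a, b[ -> y \in `]a, b[ -> f x = f y.
Proof.
move=> df; suff H x y : x \in `]a, b[ -> y \in `]a, b[ -> x <= y -> f x = f y.
  by move=> x y Ix Iy; case: (leP x y) => [|/ltW] xy; [exact: H|symmetry; exact: H].
move=> Ix Iy xy.
have sub z : x <= z <= y -> z \in `]a, b[.
  move: Ix Iy; rewrite !in_itv/= => /andP[? _] /andP[_ ?] /andP[? ?].
  by apply/andP; split; lra.
have dxy z : z \in `]x, y[ -> is_derive z 1 f 0.
  by rewrite in_itv/= => /andP[? ?]; apply/df/sub/andP; split; exact: ltW.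
have cf : {within `[x, y], continuous f}.
  apply: continuous_in_subspaceT => z; rewrite inE/= in_itv/= => zxy.
  exact: der_continuous (df z (sub z zxy)).
have [c _ /eqP] := MVT_segment xy dxy cf.
by rewrite mul0r subr_eq0 => /eqP.
Qed.

Lemma der_pos_lt (x y : R) f (df : R -> R) : x < y ->
  (forall z, x <= z <= y -> is_derive z 1 f (df z) /\ 0 < df z) -> f x < f y.
Proof.
move=> xy fdf.
have dxy z : z \in `]x, y[ -> is_derive z 1 f (df z).
  by rewrite in_itv/= => /andP[? ?]; case: (fdf z) => //; rewrite !ltW.
have cf : {within `[x, y], continuous f}.
  apply: continuous_in_subspaceT => z; rewrite inE/= in_itv/= => zxy.
  by case: (fdf z zxy) => /der_continuous.
have [c cxy fxy] := MVT xy dxy cf.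
rewrite -subr_gt0 fxy mulr_gt0 ?subr_gt0//.
by move: cxy; rewrite in_itv/= => /andP[? ?]; case: (fdf c) => //; rewrite !ltW.
Qed.

Lemma der_inverse I J f g (df : R -> R) y : open I -> open J ->
  (forall y, J y -> I (g y)) -> (forall x, I x -> J (f x)) ->
  (forall y, J y -> f (g y) = y) -> (forall x, I x -> g (f x) = x) ->
  (forall x, I x -> is_derive x 1 f (df x)) -> J y -> df (g y) != 0 ->
  is_derive y 1 g (df (g y))^-1.
Proof.
move=> oI oJ gI fJ fgK gfK fdf Jy f0; rewrite -{1}(fgK y Jy).
apply: is_derive_inverse (f0); last exact/fdf/gI.
  exact: open_near oI (gI y Jy) gfK.
apply: open_near oI (gI y Jy) _ => x Ix; exact: der_continuous (fdf x Ix).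
Qed.

End calculus.

(** * Functions with the same Schwarzian derivative *)

Section rigidity.
Context {R : realType}.

(** The function [h = sqrt (G2' / G1')] is affine in [G2]: with respect to the
    variable [G2] its derivative is [h * k], whose own derivative vanishes exactly
    because the Schwarzian derivatives agree.  Then [G1 * h] is affine in [G2]
    as well, and [G1] is the quotient. *)
Lemma mobius_rigidity (a b : R) (G1 G2 : R -> R) : a < b ->
  derivable_n 3 `]a, b[ G1 -> derivable_n 3 `]a, b[ G2 ->
  (forall z : R, z \in `]a, b[ -> 0 < derive1 G1 z) ->
  (forall z : R, z \in `]a, b[ -> 0 < derive1 G2 z) ->
  (forall z : R, z \in `]a, b[ -> schwarzian G1 z = schwarzian G2 z) ->
  exists al be ga de, forall z, z \in `]a, b[ ->
    0 < ga * G2 z + de /\ G1 z * (ga * G2 z + de) = al * G2 z + be.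
Proof.
move=> ab /derivable_n_jet3 j1 /derivable_n_jet3 j2 p1 p2 sch.
set u1 : R -> R := derive1n 1 G1 in j1; set u2 : R -> R := derive1n 2 G1 in j1.
set u3 : R -> R := derive1n 3 G1 in j1; set v1 : R -> R := derive1n 1 G2 in j2.
set v2 : R -> R := derive1n 2 G2 in j2; set v3 : R -> R := derive1n 3 G2 in j2.
have {}p1 z : z \in `]a, b[ -> 0 < u1 z by exact: p1.
have {}p2 z : z \in `]a, b[ -> 0 < v1 z by exact: p2.
have {}sch z : z \in `]a, b[ ->
    u3 z / u1 z - 3 / 2 * (u2 z / u1 z) ^+ 2 =
    v3 z / v1 z - 3 / 2 * (v2 z / v1 z) ^+ 2 by exact: sch.
pose z0 := (a + b) / 2.
have z0I : z0 \in `]a, b[ by rewrite in_itv/=; apply/andP; split; rewrite /z0; lra.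
(* the square root of [v1 z / u1 z], in a form that is easy to derive *)
pose h z := expR ((ln (v1 z) - ln (u1 z)) * 2^-1).
have h0 z : 0 < h z by exact: expR_gt0.
have h2 z : z \in `]a, b[ -> h z * h z = v1 z / u1 z.
  move=> zI; rewrite -expRD -mulrDr.
  have -> : (2^-1 + 2^-1 : R) = 1 by lra.
  by rewrite mulr1 expRB !lnK// posrE; [exact: p1|exact: p2].
pose k z := (v2 z / v1 z - u2 z / u1 z) / (2 * v1 z).
have dh z : z \in `]a, b[ -> is_derive z 1 h (h z * (k z * v1 z)).
  move=> zI; have [_ du1 _] := j1 z zI; have [_ dv1 _] := j2 z zI.
  refine (is_derive_eq (der_comp (is_derive_expR _) (derM (derB
    (der_comp (is_derive1_ln (p2 z zI)) dv1)
    (der_comp (is_derive1_ln (p1 z zI)) du1)) (derC 2^-1 z))) _).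
  rewrite -/(h z) /k; have := p1 z zI; have := p2 z zI.
  by move=> /lt0r_neq0 ? /lt0r_neq0 ?; field; apply/andP; split.
have dq z : z \in `]a, b[ -> is_derive z 1 (fun z => h z * k z) 0.
  move=> zI; have [_ du1 du2] := j1 z zI; have [_ dv1 dv2] := j2 z zI.
  have /lt0r_neq0 u10 := p1 z zI; have /lt0r_neq0 v10 := p2 z zI.
  have v20 : 2 * v1 z != 0 by rewrite mulf_neq0// pnatr_eq0.
  refine (is_derive_eq (derM (dh z zI) (derM (derB (derM dv2 (derV v10 dv1))
    (derM du2 (derV u10 du1))) (derV (f := fun z => 2 * v1 z) v20 (derM (derC 2 z) dv1)))) _).
  have e3 : v3 z = v1 z * (u3 z / u1 z - 3 / 2 * (u2 z / u1 z) ^+ 2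
                     + 3 / 2 * (v2 z / v1 z) ^+ 2).
    by rewrite sch//; field; rewrite v10.
  by rewrite /k e3; field; rewrite u10 v10.
pose ga := h z0 * k z0.
have gaE z : z \in `]a, b[ -> h z * k z = ga.
  by move=> zI; exact: (der0_cst dq zI z0I).
have dh' z : z \in `]a, b[ -> is_derive z 1 h (ga * v1 z).
  by move=> zI; apply: is_derive_eq (dh z zI) _; rewrite mulrA gaE.
pose de := h z0 - ga * G2 z0.
have hE z : z \in `]a, b[ -> h z = ga * G2 z + de.
  move=> zI; suff: h z - ga * G2 z = de by move=> <-; ring.
  apply: (der0_cst (f := fun z => h z - ga * G2 z) _ zI z0I) => y yI.
  have [dv _ _] := j2 y yI.
  refine (is_derive_eq (derB (dh' y yI) (derM (derC ga y) dv)) _).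
  by rewrite -/(v1 y); ring.
(* the derivative of [G1 * h] with respect to [G2] *)
pose al := (h z0)^-1 + ga * G1 z0.
have alE z : z \in `]a, b[ -> (h z)^-1 + ga * G1 z = al.
  move=> zI.
  apply: (der0_cst (f := fun z => (h z)^-1 + ga * G1 z) _ zI z0I) => y yI.
  have [du _ _] := j1 y yI.
  refine (is_derive_eq (derD (derV (lt0r_neq0 (h0 y)) (dh' y yI))
    (derM (derC ga y) du)) _).
  rewrite -/(u1 y) expr2 h2//.
  have /lt0r_neq0 u10 := p1 y yI; have /lt0r_neq0 v10 := p2 y yI.
  by field; rewrite u10 v10.
pose be := G1 z0 * h z0 - al * G2 z0.
exists al, be, ga, de => z zI; rewrite -hE//; split=> //.
suff: G1 z * h z - al * G2 z = be by move=> <-; ring.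
apply: (der0_cst (f := fun z => G1 z * h z - al * G2 z) _ zI z0I) => y yI.
have [dv _ _] := j2 y yI; have [du _ _] := j1 y yI.
refine (is_derive_eq (derB (derM du (dh' y yI)) (derM (derC al y) dv)) _).
rewrite -/(u1 y) -/(v1 y) -(alE y yI).
have hy := lt0r_neq0 (h0 y); have uy := lt0r_neq0 (p1 y yI).
have -> : v1 y = h y * h y * u1 y by rewrite h2// divfK.
by field; rewrite hy.
Qed.

(** A Moebius map that sends -oo to -oo has no pole elsewhere: it is affine. *)
Lemma affine_rigidity (G1 G2 : R -> R) :
  derivable_n 3 `]0, 1[ G1 -> derivable_n 3 `]0, 1[ G2 ->
  (forall z : R, z \in `]0, 1[ -> 0 < derive1 G1 z) ->
  (forall z : R, z \in `]0, 1[ -> 0 < derive1 G2 z) ->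
  (forall z : R, z \in `]0, 1[ -> schwarzian G1 z = schwarzian G2 z) ->
  (forall K, \forall z \near 0^'+, G1 z < K) ->
  (forall K, \forall z \near 0^'+, G2 z < K) ->
  exists a b : R, 0 < a /\ forall z : R, z \in `]0, 1[ -> G1 z = a * G2 z + b.
Proof.
move=> d1 d2 p1 p2 sch l1 l2.
have [al [be [ga [de H]]]] := mobius_rigidity ltr01 d1 d2 p1 p2 sch.
have ga0 : ga = 0.
  apply/eqP; apply: contraT => ga0; exfalso.
  (* Below [K2] the denominator [ga * G2 + de] is negative if [0 < ga], which is
     absurd, and exceeds 1 otherwise; then [G1 = c + e / (ga * G2 + de)] stays
     above [c - `|e|]. *)
  pose K2 := if 0 < ga then - de / ga else (1 - de) / ga.
  pose c := al / ga; pose e := be - c * de.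
  near (0 : R)^'+ => z.
  have zI : z \in `]0, 1[ by rewrite in_itv/=; apply/andP; split.
  have [h0 hG] := H z zI.
  have G2z : G2 z < K2 by near: z; exact: l2.
  have G1z : G1 z < c - `|e| by near: z; exact: l1.
  have [gap|gan] := ltP 0 ga.
    move: G2z; rewrite /K2 gap ltr_pdivlMr// => ?; nra.
  have {gan} gan : ga < 0 by rewrite lt_neqAle ga0.
  move: G2z; rewrite /K2 (lt_gtF gan) ltr_ndivlMr// => h1.
  have alE : al = c * ga by rewrite /c divfK.
  have beE : be = e + c * de by rewrite /e subrK.
  have me : - `|e| <= e by have := ler_norm (- e); rewrite normrN; lra.
  have m0 : 0 <= `|e| by [].
  set w := ga * G2 z + de in h0 hG.
  have hE : G1 z * w = c * w + e by rewrite hG /w alE beE; ring.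
  have w1 : 1 < w by rewrite /w; lra.
  have h3 : 0 < w * (c - `|e| - G1 z) by rewrite mulr_gt0// subr_gt0.
  have h4 : 0 <= `|e| * (w - 1) by rewrite mulr_ge0//; lra.
  lra.
have {}H (z : R) : z \in `]0, 1[ -> 0 < de /\ G1 z * de = al * G2 z + be.
  by move=> zI; have := H z zI; rewrite ga0 mul0r add0r.
have hI : 2^-1 \in `]0, (1 : R)[ by rewrite in_itv/=; apply/andP; split; lra.
have [de0 _] := H _ hI.
have G1E (z : R) : z \in `]0, 1[ -> G1 z = al / de * G2 z + be / de.
  move=> zI; have [_ h] := H z zI; apply: (mulIf (lt0r_neq0 de0)); rewrite h.
  by field; rewrite lt0r_neq0.
exists (al / de), (be / de); split => //.
have dG2 : is_derive (2^-1 : R) 1 G2 (derive1 G2 2^-1).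
  by apply: der_ex; exact: (d2 0%N).
have dG1 : derive1 G1 2^-1 = al / de * derive1 G2 2^-1.
  rewrite (derive1_eq_on (@open_oo _ 0 1) hI G1E).
  rewrite (der_derive1 (derD (derM (derC (al / de) 2^-1) dG2) (derC (be / de) 2^-1))).
  by rewrite mul0r add0r addr0.
by have := p1 _ hI; rewrite dG1 pmulr_lgt0// p2.
Unshelve. all: by end_near.
Qed.

End rigidity.

(** * Distortions *)

Section distortions.
Context {R : realType}.
Implicit Types (A : R -> R) (z : R).

Lemma oo01_cc z : z \in `]0, 1[ -> z \in `[0, 1].
Proof. exact: subset_itv_oo_cc. Qed.

Lemma dist_inv_cc A z : distortion A -> z \in `[0, 1] ->
  dist_inv A z \in `[0, 1] /\ A (dist_inv A z) = z.
Proof.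
case=> _ bA _ _ _ zI; split.
  have [fB _ _] : set_bij `[0, 1] `[0, 1] (dist_inv A) by exact: bijpinv_bij.
  exact: fB.
have [_ _ sA] := bA.
have H : {in `[0, 1]%classic, cancel (dist_inv A) A} by exact: surjpK.
by apply: H; rewrite inE.
Qed.

Lemma dist_inv_id A z : distortion A -> z \in `[0, 1] -> dist_inv A (A z) = z.
Proof.
case=> _ [_ iA _] _ _ _ zI.
have H : {in `[0, 1]%classic, cancel A (dist_inv A)} by exact: pinvKV.
by apply: H; rewrite inE.
Qed.

Lemma dist_lt A : distortion A -> {in `[0, 1] &, {mono A : x y / x < y}}.
Proof. by case=> _ _ mA _ _; exact: leW_mono_in. Qed.

Lemma dist0 A : distortion A -> A 0 = 0.
Proof.
move=> dA; have [_ [fA _ _] mA _ _] := dA.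
have I0 : (0 : R) \in `[0, 1] by rewrite in_itv/= lexx ler01.
have [bI bE] := dist_inv_cc dA I0.
apply/eqP; rewrite eq_le; apply/andP; split.
  by rewrite -{2}bE mA//; move: bI; rewrite in_itv/= => /andP[].
by have := fA 0 I0; rewrite /= in_itv/= => /andP[].
Qed.

Lemma dist1 A : distortion A -> A 1 = 1.
Proof.
move=> dA; have [_ [fA _ _] mA _ _] := dA.
have I0 : (1 : R) \in `[0, 1] by rewrite in_itv/= lexx ler01.
have [bI bE] := dist_inv_cc dA I0.
apply/eqP; rewrite eq_le; apply/andP; split.
  by have := fA 1 I0; rewrite /= in_itv/= => /andP[].
by rewrite -{1}bE mA//; move: bI; rewrite in_itv/= => /andP[].
Qed.

Lemma dist_oo A z : distortion A -> z \in `]0, 1[ -> A z \in `]0, 1[.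
Proof.
move=> dA zI; have zc := oo01_cc zI.
have I0 : (0 : R) \in `[0, 1] by rewrite in_itv/= lexx ler01.
have I1 : (1 : R) \in `[0, 1] by rewrite in_itv/= lexx ler01.
have := zI; rewrite in_itv/= -(dist_lt dA I0 zc) -(dist_lt dA zc I1).
by rewrite (dist0 dA) (dist1 dA) in_itv.
Qed.

Lemma dist_inv_oo A z : distortion A -> z \in `]0, 1[ -> dist_inv A z \in `]0, 1[.
Proof.
move=> dA zI; have [bI bE] := dist_inv_cc dA (oo01_cc zI).
have I0 : (0 : R) \in `[0, 1] by rewrite in_itv/= lexx ler01.
have I1 : (1 : R) \in `[0, 1] by rewrite in_itv/= lexx ler01.
rewrite in_itv/= -(dist_lt dA I0 bI) -(dist_lt dA bI I1).
by rewrite (dist0 dA) (dist1 dA) bE; move: zI; rewrite in_itv.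
Qed.

Lemma dist_inv_near0 A (e : R) : distortion A -> 0 < e ->
  \forall z \near 0^'+, dist_inv A z < e.
Proof.
move=> dA e0; pose m := Num.min e 2^-1.
have mI : m \in `]0, 1[.
  by rewrite in_itv/= lt_min e0/= gt_min invr_gt0 ltr0n/= invf_lt1 ?ltr1n// orbT.
have : 0 < A m by have := dist_oo dA mI; rewrite in_itv/= => /andP[].
move=> Am; near=> z.
have zI : z \in `]0, 1[ by rewrite in_itv/=; apply/andP; split.
have [bI bE] := dist_inv_cc dA (oo01_cc zI).
have : dist_inv A z < m by rewrite -(dist_lt dA)// ?bE//; exact: oo01_cc.
by rewrite /m lt_min => /andP[].
Unshelve. all: by end_near.
Qed.

Lemma dist_continuous A : distortion A -> {within `[0, 1], continuous A}.
Proof.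
move=> dA; have [_ [_ _ sA] mA _ _] := dA.
apply: segment_inc_surj_continuous => //.
by rewrite (dist0 dA) (dist1 dA).
Qed.

Lemma dist_inv_derivable A z : distortion A -> z \in `]0, 1[ ->
  derivable (dist_inv A) z 1.
Proof. by case=> _ _ _ _ [dB _] zI; exact: (dB 0%N). Qed.

Lemma dist_inv_der_neq0 A z : distortion A -> z \in `]0, 1[ ->
  derive1 (dist_inv A) z != 0.
Proof.
move=> dA zI; have [_ _ _ [dA3 _] _] := dA.
have bI := dist_inv_oo dA zI.
have h := der_comp (der_ex (dA3 0%N _ isT bI)) (der_ex (dist_inv_derivable dA zI)).
have bK (y : R) : `]0, 1[%classic y -> A (dist_inv A y) = y.
  by move=> yI; have [] := dist_inv_cc dA (oo01_cc yI).
have e := derive1_eq_on (@open_oo _ 0 1) zI bK.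
move: e; rewrite (der_derive1 h) (der_derive1 (derI z)) => e.
by apply/eqP => b0; move/eqP: e; rewrite b0 mulr0 eq_sym (oner_eq0 R).
Qed.

End distortions.

(** * Uniformizers and isotropy groups *)

Section uniformizers.
Context {R : realType}.
Implicit Types (A G H U : R -> R) (z a b : R) (J : set R).

Lemma schwarzian_affine (I : set R) G a b z : open I -> derivable_n 3 I G ->
  I z -> 0 < a -> schwarzian (fun y => a * G y + b) z = schwarzian G z.
Proof.
move=> oI /derivable_n_jet3 jG Iz a0.
rewrite (@schwarzian_jet3 _ I _ (fun y => a * derive1n 1 G y)
  (fun y => a * derive1n 2 G y) (fun y => a * derive1n 3 G y))//.
  by rewrite -!mulf_div divff ?lt0r_neq0// !mul1r.
move=> y Iy; have [d1 d2 d3] := jG y Iy.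
have h f d : is_derive y 1 f d -> is_derive y 1 (fun y => a * f y) (a * d).
  by move=> df; refine (is_derive_eq (derM (derC a y) df) _); rewrite mul0r add0r.
split; [|exact: h|exact: h].
by refine (is_derive_eq (derD (h _ _ d1) (derC b y)) _); rewrite addr0.
Qed.

(** The limit -oo at 0 normalizes [G] among its Moebius images; it is what makes
    the isotropy group act by affine maps. *)
Record uniformizer U G : Prop := Uniformizer {
  unif_C3 : Cn_on 3 `]0, 1[ G;
  unif_pos : forall z, z \in `]0, 1[ -> 0 < derive1 G z;
  unif_schw : forall z, z \in `]0, 1[ -> schwarzian G z = U z;
  unif_Ny : forall K, \forall z \near 0^'+, G z < K }.

Lemma unif_der U G z : uniformizer U G -> z \in `]0, 1[ ->
  is_derive z 1 G (derive1 G z).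
Proof. by case=> -[dG _] _ _ _ zI; apply: der_ex; exact: (dG 0%N). Qed.

Lemma unif_lt U G : uniformizer U G ->
  {in `]0, 1[ &, {mono G : x y / x < y}}.
Proof.
move=> uG; apply: leW_mono_in; apply: le_mono_in => x y xI yI xy.
apply: (@der_pos_lt _ _ _ _ (derive1 G) xy) => z /andP[xz zy].
have zI : z \in `]0, 1[.
  by move: xI yI; rewrite !in_itv/= => /andP[? ?] /andP[? ?]; apply/andP; split; lra.
by split; [exact: unif_der uG zI|exact: (unif_pos uG)].
Qed.

Lemma unif_inj U G : uniformizer U G -> {in `]0, 1[ &, injective G}.
Proof.
move=> uG x y xI yI e; have m := unif_lt uG.
by apply/eqP; rewrite eq_le !leNgt -(m x y)// -(m y x)// e ltxx.
Qed.

Lemma schwarzian_dist_inv U G A z : uniformizer U G -> distortion A ->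
  z \in `]0, 1[ ->
  schwarzian (fun y => G (dist_inv A y)) z = Ad_star A U z.
Proof.
move=> uG dA zI; have [[dG _] pG sG _] := uG; have [_ _ _ _ [dB _]] := dA.
have bI := dist_inv_oo dA zI.
have oI := @open_oo R 0 1.
rewrite (@schwarzian_comp _ `]0, 1[ `]0, 1[ G)//.
- by rewrite sG.
- by move=> y yI; exact: dist_inv_oo.
- by rewrite lt0r_neq0//; exact: pG.
- exact: dist_inv_der_neq0.
Qed.

Lemma dist_inv_der_gt0 A z : distortion A -> z \in `]0, 1[ ->
  0 < derive1 (dist_inv A) z.
Proof.
move=> dA zI; rewrite lt_neqAle eq_sym dist_inv_der_neq0//=.
apply: (@incr_derive1_ge0_itv _ _ true false 0 1) => //.
  by move=> y; rewrite inE => yI; exact: dist_inv_derivable.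
move=> x y xI yI xy.
have [cx ex] := dist_inv_cc dA xI.
have [cy ey] := dist_inv_cc dA yI.
by rewrite -(dist_lt dA)// ex ey.
Qed.

(** Distortions fix 0, so [G \o A^-1] also tends to -oo at 0, and
    [affine_rigidity] applies to it and [G]. *)
Lemma isotropy_affine U G A : uniformizer U G -> isotropy U A ->
  exists a b, 0 < a /\ forall z, z \in `]0, 1[ -> G (A z) = a * G z + b.
Proof.
move=> uG [dA AU]; have [cG pG sG lG] := uG; have [_ _ _ _ cB] := dA.
have bI z : z \in `]0, 1[ -> dist_inv A z \in `]0, 1[ by exact: dist_inv_oo.
have cGB : Cn_on 3 `]0, 1[ (fun y => G (dist_inv A y)).
  by apply: (Cn_on_comp (@open_oo _ 0 1) (@open_oo _ 0 1)) cG cB.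
have [||||K|a [b [a0 GB]]] := affine_rigidity cGB.1 cG.1.
- move=> z zI.
  rewrite (der_derive1 (der_comp (unif_der uG (bI z zI))
    (der_ex (dist_inv_derivable dA zI)))).
  by rewrite mulr_gt0//; [exact/pG/bI|exact: dist_inv_der_gt0].
- exact: pG.
- by move=> z zI; rewrite (schwarzian_dist_inv uG dA zI) AU// sG.
- move=> K; have [e /= e0 He] := lG K.
  near=> z.
  have zI : z \in `]0, 1[ by rewrite in_itv/=; apply/andP; split.
  have : dist_inv A z < e by near: z; exact: dist_inv_near0.
  have := bI z zI; rewrite in_itv/= => /andP[b0 _] be.
  by apply: He => //=; rewrite sub0r normrN gtr0_norm.
- exact: lG.
exists a^-1, (- b / a); split; first by rewrite invr_gt0.
move=> z zI; have := GB (A z) (dist_oo dA zI).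
rewrite (dist_inv_id dA (oo01_cc zI)) => ->.
by field; rewrite lt0r_neq0.
Unshelve. all: by end_near.
Qed.

Lemma affine_isotropy U G A a b : uniformizer U G -> distortion A -> 0 < a ->
  (forall z, z \in `]0, 1[ -> G (A z) = a * G z + b) -> isotropy U A.
Proof.
move=> uG dA a0 GA; split => // z zI.
rewrite -(schwarzian_dist_inv uG dA zI) -(unif_schw uG zI).
have a1 : 0 < a^-1 by rewrite invr_gt0.
rewrite -(schwarzian_affine (- b / a) (@open_oo _ 0 1) (unif_C3 uG).1 zI a1).
apply: (schwarzian_eq_on (@open_oo _ 0 1) zI) => y yI.
have [_ {2}<-] := dist_inv_cc dA (oo01_cc yI).
rewrite GA ?dist_inv_oo//.
by field; rewrite lt0r_neq0.
Qed.

(** * Uniformizers onto an open set *)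

(** [H] inverts [G] on [J] and is arbitrary elsewhere. *)
Record unif_onto U G J H : Prop := UnifOnto {
  uo_unif : uniformizer U G;
  uo_open : open J;
  uo_J : forall z, z \in `]0, 1[ -> J (G z);
  uo_oo : forall y, J y -> H y \in `]0, 1[;
  uo_GH : forall y, J y -> G (H y) = y }.

Lemma uo_HG U G J H z : unif_onto U G J H -> z \in `]0, 1[ -> H (G z) = z.
Proof.
move=> uo zI; have Jz := uo_J uo zI.
by apply: (unif_inj (uo_unif uo)) => //; [exact: uo_oo uo _ Jz|exact: uo_GH uo _ Jz].
Qed.

Lemma uo_der U G J H y : unif_onto U G J H -> J y ->
  is_derive y 1 H (derive1 G (H y))^-1.
Proof.
move=> uo Jy; have uG := uo_unif uo.
apply: (der_inverse (@open_oo _ 0 1) (uo_open uo) (uo_oo uo) (uo_J uo)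
  (uo_GH uo)) => //.
- by move=> x xI; exact: uo_HG uo xI.
- by move=> x xI; exact: unif_der uG xI.
- by rewrite lt0r_neq0//; exact/(unif_pos uG)/(uo_oo uo).
Qed.

Lemma uo_C3 U G J H : unif_onto U G J H -> Cn_on 3 J H.
Proof.
move=> uo; have uG := uo_unif uo.
apply: (Cn_on_inverse (@open_oo _ 0 1) (uo_open uo) (uo_oo uo) (uo_GH uo)).
- by move=> x xI; rewrite lt0r_neq0//; exact: (unif_pos uG).
- by move=> y Jy; case: (uo_der uo Jy).
- exact: unif_C3 uG.
Qed.

Lemma uo_lt U G J H x y : unif_onto U G J H -> J x -> J y -> x < y -> H x < H y.
Proof.
move=> uo Jx Jy xy; by rewrite -(unif_lt (uo_unif uo) (uo_oo uo Jx) (uo_oo uo Jy)) !(uo_GH uo).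
Qed.

(** The affine map of slope [a] and translation length [b], read in the
    coordinate [G]. *)
Definition affine_dist G H a b z :=
  if z \in `]0, 1[ then H (a * G z + b) else z.

Definition preserves J a b := forall y, J y <-> J (a * y + b).

Section affine_dist.
Variables (U G : R -> R) (J : set R) (H : R -> R).
Hypothesis uo : unif_onto U G J H.
Let uG := uo_unif uo.

Lemma affine_dist_oo a b z : preserves J a b -> z \in `]0, 1[ ->
  affine_dist G H a b z \in `]0, 1[.
Proof.
by move=> Jab zI; rewrite /affine_dist zI; apply: (uo_oo uo); apply/(Jab _).1/(uo_J uo _).
Qed.

Lemma affine_distE a b z : preserves J a b -> z \in `]0, 1[ ->
  G (affine_dist G H a b z) = a * G z + b.
Proof.
by move=> Jab zI; rewrite /affine_dist zI (uo_GH uo)//; apply/(Jab _).1/(uo_J uo _).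
Qed.

Lemma affine_dist_out a b z : z \notin `]0, 1[ -> affine_dist G H a b z = z.
Proof. by rewrite /affine_dist => /negbTE ->. Qed.

Lemma affine_dist_id : affine_dist G H 1 0 = id.
Proof.
apply/funext => z; rewrite /affine_dist; case: ifPn => // zI.
by rewrite mul1r addr0 (uo_HG uo).
Qed.

Lemma affine_dist_comp a b a' b' : preserves J a b -> preserves J a' b' ->
  affine_dist G H a b \o affine_dist G H a' b' =
  affine_dist G H (a * a') (a * b' + b).
Proof.
move=> J1 J2; apply/funext => z /=.
case: (boolP (z \in `]0, 1[)) => zI; last by rewrite !affine_dist_out.
rewrite {1}/affine_dist affine_dist_oo// affine_distE// /affine_dist zI.
by congr H; ring.
Qed.

Lemma preserves_inv a b : 0 < a -> preserves J a b -> preserves J a^-1 (- b / a).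
Proof.
move=> a0 Jab y; rewrite (Jab (_ + _)).
suff -> : a * (a^-1 * y + - b / a) + b = y by [].
by field; rewrite lt0r_neq0.
Qed.

Lemma affine_dist_invK a b z : 0 < a -> preserves J a b ->
  affine_dist G H a b (affine_dist G H a^-1 (- b / a) z) = z.
Proof.
move=> a0 Jab; have J' := preserves_inv a0 Jab.
rewrite -[LHS]/((affine_dist G H a b \o _) z) affine_dist_comp//.
have -> : a * a^-1 = 1 by rewrite mulfV// lt0r_neq0.
have -> : a * (- b / a) + b = 0 by field; rewrite lt0r_neq0.
by rewrite affine_dist_id.
Qed.

Lemma affine_distK a b z : 0 < a -> preserves J a b ->
  affine_dist G H a^-1 (- b / a) (affine_dist G H a b z) = z.
Proof.
move=> a0 Jab; have J' := preserves_inv a0 Jab.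
rewrite -[LHS]/((affine_dist G H _ _ \o _) z) affine_dist_comp//.
have -> : a^-1 * a = 1 by rewrite mulVf// lt0r_neq0.
have -> : a^-1 * b + - b / a = 0 by field; rewrite lt0r_neq0.
by rewrite affine_dist_id.
Qed.

Lemma affine_dist_cc a b z : preserves J a b -> z \in `[0, 1] ->
  affine_dist G H a b z \in `[0, 1].
Proof.
move=> Jab zI; case: (boolP (z \in `]0, 1[)) => zo.
  by apply: oo01_cc; exact: affine_dist_oo.
by rewrite affine_dist_out.
Qed.

Lemma affine_dist_bij a b : 0 < a -> preserves J a b ->
  set_bij `[0, 1] `[0, 1] (affine_dist G H a b).
Proof.
move=> a0 Jab; split.
- by move=> z zI; exact: affine_dist_cc.
- by move=> x y _ _ /(congr1 (affine_dist G H a^-1 (- b / a))); rewrite !affine_distK.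
- move=> z zI; exists (affine_dist G H a^-1 (- b / a) z).
    by apply: affine_dist_cc => //; exact: preserves_inv.
  exact: affine_dist_invK.
Qed.

Lemma affine_dist_inv a b : 0 < a -> preserves J a b ->
  dist_inv (affine_dist G H a b) = affine_dist G H a^-1 (- b / a).
Proof.
move=> a0 Jab; have bij := affine_dist_bij a0 Jab; have [fB iB sB] := bij.
apply/funext => z; case: (boolP (z \in `[0, 1])) => zI; last first.
  rewrite affine_dist_out; last by apply: contra zI => /oo01_cc.
  rewrite /dist_inv /pinv_ splitV /= oinv_surj.
  case: pselect => // -[x xI xz]; exfalso; move/negP: zI; apply.
  by rewrite -xz; exact: fB.
have E : {in `[0, 1]%classic, cancel (affine_dist G H a b)
    (dist_inv (affine_dist G H a b))} by exact: pinvKV.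
rewrite -{1}(affine_dist_invK z a0 Jab) E// inE.
by apply: affine_dist_cc => //; exact: preserves_inv.
Qed.

Lemma affine_dist_lt a b : 0 < a -> preserves J a b ->
  {in `[0, 1] &, {homo affine_dist G H a b : x y / x < y}}.
Proof.
move=> a0 Jab x y; rewrite !in_itv/= => /andP[x0 x1] /andP[y0 y1] xy.
have [xI|] := boolP (x \in `]0, 1[); have [yI|] := boolP (y \in `]0, 1[).
- rewrite /affine_dist xI yI; apply: (uo_lt uo).
  + by apply/(Jab _).1/(uo_J uo _).
  + by apply/(Jab _).1/(uo_J uo _).
  + by rewrite ltrD2r ltr_pM2l// (unif_lt uG).
- move=> yI; rewrite (affine_dist_out _ _ yI).
  have -> : y = 1.
    apply/eqP; apply: contraR yI => yn; rewrite in_itv/=; apply/andP; split.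
      by rewrite (le_lt_trans x0 xy).
    by rewrite lt_neqAle yn.
  by have := affine_dist_oo Jab xI; rewrite in_itv/= => /andP[].
- move=> xI; rewrite (affine_dist_out _ _ xI).
  have -> : x = 0.
    apply/eqP; apply: contraR xI => xn; rewrite in_itv/=; apply/andP; split.
      by rewrite lt_neqAle eq_sym xn.
    by rewrite (lt_le_trans xy).
  by have := affine_dist_oo Jab yI; rewrite in_itv/= => /andP[].
- by move=> yI xI; rewrite !affine_dist_out.
Qed.

Lemma affine_dist_C3 a b : preserves J a b -> Cn_on 3 `]0, 1[ (affine_dist G H a b).
Proof.
move=> Jab; apply: (@Cn_on_eq _ _ _ (fun z => H (a * G z + b)) _ (@open_oo _ 0 1)).
  by move=> z zI; rewrite /affine_dist ifT.
have oI := @open_oo R 0 1.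
apply: (Cn_on_comp oI (uo_open uo)); last 2 first.
- exact: uo_C3 uo.
- by apply: Cn_onD (Cn_on_cst _ _ oI) => //; apply: Cn_onM (Cn_on_cst _ _ oI) _ => //;
     exact: unif_C3 uG.
- by move=> z zI; apply/(Jab _).1/(uo_J uo _).
Qed.

Lemma affine_dist_distortion a b : 0 < a -> preserves J a b ->
  distortion (affine_dist G H a b).
Proof.
move=> a0 Jab; split.
- by move=> z zI; apply: affine_dist_out; apply: contra zI => /oo01_cc.
- exact: affine_dist_bij.
- by apply: le_mono_in; exact: affine_dist_lt.
- exact: affine_dist_C3.
- by rewrite affine_dist_inv//; apply: affine_dist_C3; exact: preserves_inv.
Qed.

Lemma affine_dist_isotropy a b : 0 < a -> preserves J a b ->
  isotropy U (affine_dist G H a b).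
Proof.
move=> a0 Jab; apply: (affine_isotropy uG _ a0 (b := b)).
  exact: affine_dist_distortion.
by move=> z zI; exact: affine_distE.
Qed.

(** An affine map that represents a distortion must permute the range [J] of
    [G], because the distortion permutes ]0, 1[. *)
Lemma isotropyP A : isotropy U A <->
  exists a b, [/\ 0 < a, preserves J a b & A = affine_dist G H a b].
Proof.
split=> [isoA|[a [b [a0 Jab ->]]]]; last exact: affine_dist_isotropy.
have [dA _] := isoA; have [a [b [a0 GA]]] := isotropy_affine uG isoA.
exists a, b; split=> //.
  move=> y; split=> Jy.
    rewrite -(uo_GH uo Jy) -GA; last exact: uo_oo uo _ Jy.
    by apply/(uo_J uo)/(dist_oo dA)/(uo_oo uo).
  have wI := uo_oo uo Jy; have bI := dist_inv_oo dA wI.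
  have [_ e] := dist_inv_cc dA (oo01_cc wI).
  suff -> : y = G (dist_inv A (H (a * y + b))) by exact: uo_J uo _ bI.
  have := GA _ bI; rewrite e (uo_GH uo Jy) => /addIr.
  by move=> /(mulfI (lt0r_neq0 a0)).
apply/funext => z; rewrite /affine_dist; case: ifPn => zI.
  by rewrite -GA// (uo_HG uo)//; exact: dist_oo.
have [zc|zc] := boolP (z \in `[0, 1]); last exact: (distortion_out dA).
move: zc zI; rewrite !in_itv/= => /andP[z0 z1] zI.
have [->|zn0] := eqVneq z 0; first exact: dist0.
have [->|zn1] := eqVneq z 1; first exact: dist1.
by exfalso; move/negP: zI; apply; rewrite !lt_neqAle eq_sym zn0 z0 zn1.
Qed.

End affine_dist.

End uniformizers.

(** * Lie group dimension *)

Section lie.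
Context {R : realType}.

(** A class of functions closed under partial derivation, so that smoothness of
    all orders follows at once; the group law and the inverse of affine maps, in
    the coordinates (log-slope, translation length), belong to it. *)
Inductive expoly (d : nat) : ('rV[R]_d -> R) -> Prop :=
| expoly_cst c : expoly (fun=> c)
| expoly_coord i : expoly (fun p => p 0 i)
| expoly_exp c i : expoly (fun p => expR (c * p 0 i))
| expolyD f g : expoly f -> expoly g -> expoly (fun p => f p + g p)
| expolyM f g : expoly f -> expoly g -> expoly (fun p => f p * g p).

Lemma expoly_continuous (d : nat) (f : 'rV[R]_d -> R) : expoly f -> continuous f.
Proof.
elim=> {f} [c|i|c i|f g _ cf _ cg|f g _ cf _ cg] p.
- exact: cst_continuous.
- exact: coord_continuous.
- apply: continuous_comp; last exact: continuous_expR.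
  by apply: continuousM; [exact: cst_continuous|exact: coord_continuous].
- by apply: continuousD; [exact: cf|exact: cg].
- by apply: continuousM; [exact: cf|exact: cg].
Qed.

Lemma line_coord (d : nat) (p : 'rV[R]_d) (i j : 'I_d) (t : R) :
  (p + t *: delta_mx 0 j) 0 i = p 0 i + t * (j == i)%:R.
Proof. by rewrite !mxE eqxx/= eq_sym. Qed.

Lemma expoly_partial (d : nat) (f : 'rV[R]_d -> R) (j : 'I_d) : expoly f ->
  exists2 df, expoly df & forall p,
    is_derive (0 : R) (1 : R) (fun t => f (p + t *: delta_mx 0 j)) (df p).
Proof.
elim=> {f} [c|i|c i|f g ef [df edf dfP] eg [dg edg dgP]
  |f g ef [df edf dfP] eg [dg edg dgP]].
- by exists (fun=> 0); [exact: expoly_cst|move=> p; exact: derC].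
- exists (fun=> (j == i)%:R); first exact: expoly_cst.
  move=> p; under eq_fun do rewrite line_coord.
  refine (is_derive_eq (derD (derC (p 0 i) 0) (derM (derI 0) (derC _ 0))) _).
  by rewrite mulr0 addr0 add0r mul1r.
- exists (fun p => c * (j == i)%:R * expR (c * p 0 i)).
    by apply: expolyM; [exact: expoly_cst|exact: expoly_exp].
  move=> p; under eq_fun do rewrite line_coord.
  refine (is_derive_eq (der_comp (is_derive_expR _) (derM (derC c 0)
   (derD (derC (p 0 i) 0) (derM (derI 0) (derC _ 0))))) _).
  by rewrite !mul0r !addr0 !add0r mul1r mulrC.
- exists (fun p => df p + dg p); first exact: expolyD.
  by move=> p; exact: derD (dfP p) (dgP p).
- exists (fun p => df p * g p + f p * dg p).
    by apply: expolyD; apply: expolyM.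
  move=> p; refine (is_derive_eq (derM (dfP p) (dgP p)) _).
  by rewrite scale0r addr0.
Qed.

Lemma partialE (d : nat) (f df : 'rV[R]_d -> R) (j : 'I_d) :
  (forall p, is_derive (0 : R) (1 : R) (fun t => f (p + t *: delta_mx 0 j)) (df p)) ->
  partial j f = df.
Proof. by move=> h; apply/funext => p; rewrite /partial (der_derive1 (h p)). Qed.

Lemma expoly_Ck (d k : nat) (W : set 'rV[R]_d) (f : 'rV[R]_d -> R) :
  expoly f -> Ck k W f.
Proof.
elim: k f => [|k IH] f ef; split=> //; first by move=> p _; exact: expoly_continuous.
  by move=> p _; exact: expoly_continuous.
move=> j.
have [df edf dfP] := expoly_partial j ef; split=> [p _|].
  by case: (dfP p).
by rewrite (partialE dfP); exact: IH.
Qed.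

Lemma sum_delta (d : nat) (i : 'I_d) (c : 'I_d -> R) :
  \sum_j c j * (j == i)%:R = c i.
Proof.
rewrite (bigD1 i)//= eqxx mulr1 big1 ?addr0// => j /negbTE ->.
by rewrite mulr0.
Qed.

Section affine_group.
Variables (U G : R -> R) (J : set R) (H : R -> R).
Hypothesis uo : unif_onto U G J H.
Let uG := uo_unif uo.

(* The point [p] parametrizes the affine map of slope [expR (p 0 i1)] and
   translation length [s * p 0 i2]; the vectors [k1] and [k2] recover [p] from
   the log-slope and the length.  For the dilations [d = 1], [s = 0], [k2 = 0];
   for all the affine maps [d = 2], [s = 1], and [k1], [k2] is the canonical
   basis. *)
Variables (d : nat) (i1 i2 : 'I_d) (s : R) (k1 k2 : 'rV[R]_d).
Hypothesis k12K : forall p : 'rV[R]_d, p 0 i1 *: k1 + (s * p 0 i2) *: k2 = p.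
Hypothesis k12P : forall x y, preserves J (expR x) y ->
  (x *: k1 + y *: k2) 0 i1 = x /\ s * (x *: k1 + y *: k2) 0 i2 = y.
Hypothesis Jp : forall p : 'rV[R]_d, preserves J (expR (p 0 i1)) (s * p 0 i2).

Let par (p : 'rV[R]_d) := affine_dist G H (expR (p 0 i1)) (s * p 0 i2).
Let z1 : R := 3^-1.
Let z2 : R := 2^-1.
(* The slope and the translation length of an affine map are read from its values
   at two points, hence are continuous for pointwise convergence. *)
Let slope (A : R -> R) := (G (A z2) - G (A z1)) / (G z2 - G z1).
Let coord (A : R -> R) := ln (slope A) *: k1 + (G (A z1) - slope A * G z1) *: k2.

Let z1I : z1 \in `]0, 1[.
Proof. by rewrite in_itv/=; apply/andP; split; rewrite /z1; lra. Qed.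
Let z2I : z2 \in `]0, 1[.
Proof. by rewrite in_itv/=; apply/andP; split; rewrite /z2; lra. Qed.
Let G12 : 0 < G z2 - G z1.
Proof. by rewrite subr_gt0 (unif_lt uG)// /z1 /z2; lra. Qed.

Let slopeE a b : preserves J a b -> slope (affine_dist G H a b) = a.
Proof.
move=> Jab; rewrite /slope !(affine_distE uo)//.
by have := lt0r_neq0 G12 => ?; field.
Qed.

Let coordE x y : preserves J (expR x) y ->
  coord (affine_dist G H (expR x) y) = x *: k1 + y *: k2.
Proof.
move=> Jxy; rewrite /coord slopeE// (affine_distE uo)// expRK.
by congr (_ + _ *: _); ring.
Qed.

Let parK p : coord (par p) = p.
Proof. by rewrite /par coordE ?k12K. Qed.

Let par_range : isotropy U = \bigcup_(i in [set: unit]) (par @` setT).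
Proof.
apply/seteqP; split=> [A|A [_ _] [p _ <-]].
  move=> /(isotropyP uo)[a [b [a0 Jab ->]]].
  have aE : a = expR (ln a) by rewrite lnK.
  have Jab' : preserves J (expR (ln a)) b by rewrite -aE.
  have [e1 e2] := k12P Jab'.
  exists tt => //; exists (ln a *: k1 + b *: k2) => //.
  by rewrite /par e1 e2 -aE.
by apply: (affine_dist_isotropy uo) => //; exact: expR_gt0.
Qed.

Let par_comp p q : par p \o par q =
  affine_dist G H (expR (p 0 i1 + q 0 i1)) (expR (p 0 i1) * (s * q 0 i2) + s * p 0 i2).
Proof. by rewrite /par (affine_dist_comp uo)// expRD. Qed.

Let preserves_comp a b a' b' : preserves J a b -> preserves J a' b' ->
  preserves J (a * a') (a * b' + b).
Proof.
move=> h h' y; rewrite (h' y) (h _).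
by have -> : a * (a' * y + b') + b = a * a' * y + (a * b' + b) by ring.
Qed.

Let par_compE p q : coord (par p \o par q) =
  (p 0 i1 + q 0 i1) *: k1 + (expR (p 0 i1) * (s * q 0 i2) + s * p 0 i2) *: k2.
Proof.
by rewrite par_comp coordE// expRD; exact: preserves_comp.
Qed.

Let par_inv p : dist_inv (par p) =
  affine_dist G H (expR (- p 0 i1)) (- (s * p 0 i2) * expR (- p 0 i1)).
Proof. by rewrite /par (affine_dist_inv uo)// ?expR_gt0// expRN. Qed.

Let par_invE p : coord (dist_inv (par p)) =
  (- p 0 i1) *: k1 + (- (s * p 0 i2) * expR (- p 0 i1)) *: k2.
Proof.
rewrite par_inv coordE// expRN; apply: preserves_inv => //; exact: expR_gt0.
Qed.

(* the value at [z] of the affine map of parameter [p]; the factor 1 matches the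
   shape of the exponentials in [expoly] *)
Let wdef z (p : 'rV[R]_d) := expR (1 * p 0 i1) * G z + s * p 0 i2.

Let expoly_w z : expoly (wdef z).
Proof.
apply: expolyD; apply: expolyM.
- exact: expoly_exp.
- exact: expoly_cst.
- exact: expoly_cst.
- exact: expoly_coord.
Qed.

Let Jw z p : z \in `]0, 1[ -> J (wdef z p).
Proof. by move=> zI; rewrite /wdef mul1r; apply/(Jp _ _).1/(uo_J uo _). Qed.

Let parE (z : R) p : z \in `]0, 1[ -> par p z = H (wdef z p).
Proof. by move=> zI; rewrite /par /affine_dist zI /wdef mul1r. Qed.

Let der_par (z : R) (j : 'I_d) (dw : 'rV[R]_d -> R) (p : 'rV[R]_d) : z \in `]0, 1[ ->
  (forall p : 'rV[R]_d,
     is_derive (0 : R) (1 : R) (fun t => wdef z (p + t *: delta_mx 0 j)) (dw p)) ->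
  is_derive (0 : R) (1 : R) (fun t => par (p + t *: delta_mx 0 j) z)
    (derive1 H (wdef z p) * dw p).
Proof.
move=> zI wP; under eq_fun do rewrite parE//.
have dH : is_derive (wdef z (p + 0 *: delta_mx 0 j)) 1 H (derive1 H (wdef z p)).
  rewrite scale0r addr0; apply: der_ex.
  by case: (uo_der uo (Jw p zI)).
exact: (der_comp (g := fun t => wdef z (p + t *: delta_mx 0 j)) dH (wP p)).
Qed.

Let par_cont z : continuous (fun p => par p z).
Proof.
have [zI|zI] := boolP (z \in `]0, 1[).
  under eq_fun do rewrite parE//.
  move=> p; apply: (@continuous_comp _ _ _ (wdef z) H).
    exact: expoly_continuous.
  exact: der_continuous (uo_der uo (Jw p zI)).
have -> : (fun p => par p z) = (fun=> z).
  by apply/funext => p; rewrite /par affine_dist_out.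
exact: cst_continuous.
Qed.

Let par_C1 (z : R) : z \in `]0, 1[ -> Ck 1 setT (fun p => par p z).
Proof.
move=> zI; split=> [p _|j]; first exact: par_cont.
have [dw edw wP] := expoly_partial j (expoly_w z).
have dP p := der_par p zI wP.
split=> [p _|]; first by case: (dP p).
split=> [p _|//]; rewrite (partialE dP).
have c1 : {for p, continuous (fun p => derive1 H (wdef z p))}.
  apply: (@continuous_comp _ _ _ (wdef z) (derive1 H)).
    exact: expoly_continuous.
  have /Cn_onS[_ /(Cn_on_le (m := 0) isT)] := uo_C3 uo.
  by move=> /Cn_on0; apply; exact: Jw.
by apply: (continuousM c1); exact: expoly_continuous.
Qed.

Let par_free p (c : 'rV[R]_d) :
  (forall z, z \in `]0, 1[ ->
     \sum_(j < d) c 0 j * partial j (fun q => par q z) p = 0) -> c = 0.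
Proof.
move=> h.
have {}h z : z \in `]0, 1[ -> expR (p 0 i1) * G z * c 0 i1 + s * c 0 i2 = 0.
  move=> zI; have := h z zI.
  have dH : derive1 H (wdef z p) != 0.
    rewrite (der_derive1 (uo_der uo (Jw p zI))) invr_eq0 lt0r_neq0//.
    by apply: (unif_pos uG); apply: (uo_oo uo); exact: Jw.
  pose dw (j : 'I_d) (q : 'rV[R]_d) :=
    (j == i1)%:R * expR (1 * q 0 i1) * G z + s * (j == i2)%:R.
  have wP j q : is_derive (0 : R) (1 : R)
      (fun t => wdef z (q + t *: delta_mx 0 j)) (dw j q).
    rewrite /wdef; under eq_fun do rewrite !line_coord.
    refine (is_derive_eq (derD (derM (der_comp (is_derive_expR _)
      (derM (derC 1 0) (derD (derC (q 0 i1) 0) (derM (derI 0) (derC _ 0)))))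
      (derC (G z) 0)) (derM (derC s 0)
      (derD (derC (q 0 i2) 0) (derM (derI 0) (derC _ 0))))) _).
    by rewrite /dw !mul0r !mulr0 !addr0 !add0r !mul1r [expR _ * _]mulrC.
  under eq_bigr => j _.
    rewrite (partialE (fun q => der_par q zI (wP j))) /dw.
    rewrite (_ : c 0 j * _ = derive1 H (wdef z p) *
      (expR (p 0 i1) * G z * (c 0 j * (j == i1)%:R) + s * (c 0 j * (j == i2)%:R)));
      last by rewrite mul1r; ring.
    over.
  rewrite -mulr_sumr big_split/= -!mulr_sumr !sum_delta.
  by move/eqP; rewrite mulf_eq0 (negbTE dH)/= => /eqP.
have h1 := h _ z1I; have h2 := h _ z2I.
have c1 : c 0 i1 = 0.
  have : expR (p 0 i1) * (G z2 - G z1) * c 0 i1 = 0.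
    by rewrite -[RHS](subrr 0) -{1}h2 -h1; ring.
  by move/eqP; rewrite mulf_eq0 mulf_eq0 expR_eq0 (gt_eqF G12) => /eqP.
have c2 : s * c 0 i2 = 0 by move: h1; rewrite c1 mulr0 add0r.
by rewrite -(k12K c) c1 c2 !scale0r addr0.
Qed.

Let coord_cvg (T : Type) (F : set_system T) (u v : T -> R) (x y c g : R) :
  ProperFilter F -> 0 < (y - x) / c -> u t @[t --> F] --> x -> v t @[t --> F] --> y ->
  (ln ((v t - u t) / c) *: k1 + (u t - (v t - u t) / c * g) *: k2) @[t --> F] -->
  ln ((y - x) / c) *: k1 + (x - (y - x) / c * g) *: k2.
Proof.
move=> FF s0 ux vy.
have sl : (v t - u t) / c @[t --> F] --> (y - x) / c.
  by apply: cvgM; [exact: cvgB|exact: cvg_cst].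
apply: cvgD; apply: cvgZr_tmp.
  by apply: continuous_cvg sl; exact: continuous_ln.
by apply: cvgB => //; apply: cvgM => //; exact: cvg_cst.
Qed.

Let coord_cont A : isotropy U A ->
  {for A, continuous (coord : {ptws R -> R} -> 'rV[R]_d)}.
Proof.
move=> [dA AU]; have [a [b [a0 GA]]] := isotropy_affine uG (conj dA AU).
have ev (z : R) : z \in `]0, 1[ ->
    G ((B : {ptws R -> R}) z) @[B --> (A : {ptws R -> R})] --> G (A z).
  move=> zI; apply: (@continuous_comp _ _ _ (fun B : {ptws R -> R} => B z) G).
    have /pointwise_cvgP : {ptws, nbhs (A : {ptws R -> R}) --> (A : {ptws R -> R})}.
      exact: cvg_id.
    exact.
  exact: der_continuous (unif_der uG (dist_oo dA zI)).
have pos : 0 < (G (A z2) - G (A z1)) / (G z2 - G z1).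
  by rewrite !GA// divr_gt0// (_ : _ - _ = a * (G z2 - G z1)) ?mulr_gt0//; ring.
Timeout 30 have h := @coord_cvg {ptws R -> R} (nbhs (A : {ptws R -> R})) (fun B => G (B z1))
  (fun B => G (B z2)) (G (A z1)) (G (A z2)) (G z2 - G z1) (G z1)
  (@nbhs_pfilter {ptws R -> R} A) pos
  (ev _ z1I) (ev _ z2I).
Timeout 30 exact: h.
Qed.

Lemma isotropy_lie_dim : has_lie_dim (isotropy U) d.
Proof.
exists unit, (fun=> setT), (fun=> par), (fun=> coord).
have inG p : isotropy U (par p) by rewrite par_range; exists tt => //; exists p.
have rangeE : par @` setT = isotropy U.
  by rewrite par_range; apply/seteqP; split=> [A ?|A [_ _] //]; exists tt.
split.
- by move=> A [].
- apply/(isotropyP uo).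
  exists 1, 0; split => //; first by move=> y; rewrite mul1r addr0.
  by rewrite (affine_dist_id uo).
- move=> A B; rewrite -rangeE => -[p _ <-] [q _ <-]; rewrite rangeE par_comp.
  rewrite expRD; apply: (affine_dist_isotropy uo); first by rewrite mulr_gt0 ?expR_gt0.
  exact: preserves_comp.
- move=> A; rewrite -rangeE => -[p _ <-]; rewrite rangeE par_inv.
  rewrite expRN; apply: (affine_dist_isotropy uo); first by rewrite invr_gt0 expR_gt0.
  by apply: preserves_inv; [exact: expR_gt0|exact: Jp].
- by move=> _; exact: openT.
- exact: par_range.
- by move=> _; exists setT; [exact: openT|rewrite rangeE setIT].
- by move=> _ p _; exact: parK.
- move=> _ p _; have FF : Filter (par q @[q --> p]) by apply: fmap_filter; exact: nbhs_filter.
  apply: ((@pointwise_cvgP R R (par q @[q --> p]) (par p) FF).2) => z.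
  exact: par_cont.
- move=> _; rewrite rangeE; apply: continuous_in_subspaceT => A.
  by rewrite inE => /coord_cont.
- move=> _ _ k j.
  have -> : (fun p => coord (par p) 0 j) = (fun p => p 0 j).
    by apply/funext => p; rewrite parK.
  exact/expoly_Ck/expoly_coord.
- move=> _ _ _ k j.
  have -> : (fun p : 'rV[R]_(d + d) => coord (par (lsubmx p) \o par (rsubmx p)) 0 j) =
      (fun p => (p 0 (lshift d i1) + p 0 (rshift d i1)) * k1 0 j +
        (expR (p 0 (lshift d i1)) * (s * p 0 (rshift d i2)) +
         s * p 0 (lshift d i2)) * k2 0 j).
    by apply/funext => p; rewrite par_compE !mxE.
  apply: expoly_Ck; apply: expolyD; apply: expolyM; try exact: expoly_cst.
    by apply: expolyD; exact: expoly_coord.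
  apply: expolyD; apply: expolyM; try exact: expoly_cst; last exact: expoly_coord.
    rewrite (_ : (fun _ => _) = fun p : 'rV[R]_(d + d) => expR (1 * p 0 (lshift d i1))).
      exact: expoly_exp.
    by apply/funext => p; rewrite mul1r.
  by apply: expolyM; [exact: expoly_cst|exact: expoly_coord].
- move=> _ _ k j.
  have -> : (fun p => coord (dist_inv (par p)) 0 j) =
      (fun p => - p 0 i1 * k1 0 j + - (s * p 0 i2) * expR (- p 0 i1) * k2 0 j).
    by apply/funext => p; rewrite par_invE !mxE.
  have eN : expoly (fun p : 'rV[R]_d => - p 0 i1).
    rewrite (_ : (fun _ => _) = fun p : 'rV[R]_d => -1 * p 0 i1).
      by apply: expolyM; [exact: expoly_cst|exact: expoly_coord].
    by apply/funext => p; rewrite mulN1r.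
  apply: expoly_Ck; apply: expolyD; apply: expolyM; try exact: expoly_cst.
    exact: eN.
  apply: expolyM.
    rewrite (_ : (fun _ => _) = fun p : 'rV[R]_d => - s * p 0 i2).
      by apply: expolyM; [exact: expoly_cst|exact: expoly_coord].
    by apply/funext => p; rewrite mulNr.
  rewrite (_ : (fun _ => _) = fun p : 'rV[R]_d => expR (-1 * p 0 i1)).
    exact: expoly_exp.
  by apply/funext => p; rewrite mulN1r.
- by move=> _ z zI; exact: par_C1.
- by move=> _ p c _; exact: par_free.
Qed.

End affine_group.

(** In the coordinate [G] every isotropy acts by an affine map, which two values
    determine: the weights [1 - l z] and [l z] below interpolate between [z1] and
    [z2].  The values of the generators at [z1] and [z2] form a matrix with two
    columns and [d >= 3] rows, so some combination of the generators vanishes at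
    both points, hence everywhere. *)
Lemma no_lie_dim3 (U G : R -> R) (d : nat) : uniformizer U G -> (3 <= d)%N ->
  ~ has_lie_dim (isotropy U) d.
Proof.
move=> uG d3 [I [dom [par [coord L]]]].
pose z1 : R := 3^-1; pose z2 : R := 2^-1.
have z1I : z1 \in `]0, 1[ by rewrite in_itv/=; apply/andP; split; rewrite /z1; lra.
have z2I : z2 \in `]0, 1[ by rewrite in_itv/=; apply/andP; split; rewrite /z2; lra.
have G12 : 0 < G z2 - G z1 by rewrite subr_gt0 (unif_lt uG)// /z1 /z2; lra.
pose l z := (G z - G z1) / (G z2 - G z1).
have Gl A z : isotropy U A -> z \in `]0, 1[ ->
    G (A z) = (1 - l z) * G (A z1) + l z * G (A z2).
  move=> /(isotropy_affine uG)[a [b [_ GA]]] zI; rewrite !GA// /l.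
  by have := lt0r_neq0 G12 => ?; field.
have := lie_id L; rewrite {1}(lie_cover L) => -[i _ [p domp _]].
have parG q : dom i q -> isotropy U (par i q).
  by move=> dq; rewrite (lie_cover L); exists i => //; exists q.
pose e (j : 'I_d) z := partial j (fun q => par i q z) p.
have de (j : 'I_d) z : z \in `]0, 1[ -> is_derive (0 : R) (1 : R)
    (fun t => G (par i (p + t *: delta_mx 0 j) z)) (derive1 G (par i p z) * e j z).
  move=> zI; have [_ /(_ j)[dpar _]] := lie_eval_C1 L i zI.
  apply: (der_comp (f := G)); last by apply: der_ex; exact: dpar.
  rewrite scale0r addr0; apply: (unif_der uG).
  by apply: dist_oo zI; case: (parG p domp).
have line_dom (j : 'I_d) : \forall t \near (0 : R), dom i (p + t *: delta_mx 0 j).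
  have cl : continuous (fun t : R => p + t *: delta_mx 0 j).
    by move=> t; apply: cvgD; [exact: cvg_cst|apply: cvgZr_tmp; exact: cvg_id].
  apply: (cl 0); rewrite scale0r addr0.
  by apply: open_nbhs_nbhs; split=> //; exact: lie_dom_open L i.
have eE (j : 'I_d) z : z \in `]0, 1[ -> derive1 G (par i p z) * e j z =
    (1 - l z) * (derive1 G (par i p z1) * e j z1) +
    l z * (derive1 G (par i p z2) * e j z2).
  move=> zI.
  have := derD (derM (derC (1 - l z) 0) (de j z1 z1I)) (derM (derC (l z) 0) (de j z2 z2I)).
  rewrite !mul0r !add0r => h; rewrite -(der_derive1 h) -(der_derive1 (de j z zI)).
  rewrite !derive1E; apply: near_eq_derive; near=> t.
  by apply: Gl => //; apply: parG; near: t; exact: line_dom.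
pose M : 'M[R]_(d, 2) := \matrix_(j < d, k < 2) e j (if k == 0 then z1 else z2).
have : kermx M != 0.
  rewrite -mxrank_eq0 mxrank_ker -lt0n subn_gt0.
  by apply: leq_ltn_trans (rank_leq_col _) _.
case/rowV0Pn => c /sub_kermxP cM /negP; apply; apply/eqP.
apply: (lie_eval_free L domp) => z zI.
have ck k : \sum_(j < d) c 0 j * e j (if k == 0 :> 'I_2 then z1 else z2) = 0.
  have := congr1 (fun X : 'rV[R]_2 => X 0 k) cM; rewrite !mxE => h; rewrite -[RHS]h.
  by apply: eq_bigr => j _; rewrite mxE.
have c1 := ck 0; have c2 := ck 1; rewrite /= in c1 c2.
have Gp : derive1 G (par i p z) != 0.
  rewrite lt0r_neq0//; apply: (unif_pos uG); apply: dist_oo zI.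
  by case: (parG p domp).
apply: (mulfI Gp); rewrite mulr0 mulr_sumr.
transitivity ((1 - l z) * derive1 G (par i p z1) * (\sum_(j < d) c 0 j * e j z1) +
  l z * derive1 G (par i p z2) * (\sum_(j < d) c 0 j * e j z2)).
  rewrite !mulr_sumr -big_split/=; apply: eq_bigr => j _.
  by rewrite mulrCA [_ * partial _ _ _]eE//; ring.
by rewrite c1 c2 !mulr0 addr0.
Unshelve. all: by end_near.
Qed.

End lie.

(** * Constant potentials *)

Section constant_potentials.
Context {R : realType}.

(** The derivative of each of [s] and [s1] is a multiple of the other. *)
Lemma oscillator_Cn (n : nat) (k : R) (s s1 : R -> R) :
  (forall x : R, is_derive x 1 s (s1 x)) ->
  (forall x : R, is_derive x 1 s1 (- k * s x)) ->
  Cn_on n `]0, 1[ s /\ Cn_on n `]0, 1[ s1.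
Proof.
move=> ds ds1; have oI := @open_oo R 0 1.
elim: n => [|n [IH IH1]]; split.
- by apply/Cn_on0 => x _; exact: der_continuous (ds x).
- by apply/Cn_on0 => x _; exact: der_continuous (ds1 x).
- exact: (Cn_onS_der oI (fun x _ => ds x)).
- apply: (Cn_onS_der oI (fun x _ => ds1 x)).
  exact: (Cn_onM oI (Cn_on_cst _ _ oI) IH).
Qed.

Section ratio.
Variables (k w : R) (r s r1 s1 : R -> R).
Hypothesis dr : forall x : R, is_derive x 1 r (r1 x).
Hypothesis dr1 : forall x : R, is_derive x 1 r1 (- k * r x).
Hypothesis ds : forall x : R, is_derive x 1 s (s1 x).
Hypothesis ds1 : forall x : R, is_derive x 1 s1 (- k * s x).
Hypothesis wE : forall x : R, r x * s1 x - r1 x * s x = w.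
Hypothesis w0 : 0 < w.
Hypothesis s_gt0 : forall x : R, x \in `]0, 1[ -> 0 < s x.
Hypothesis s0 : s 0 = 0.
Hypothesis r0 : 0 < r 0.

Let G (z : R) := - r z / s z.

Let dG (z : R) : z \in `]0, 1[ -> is_derive z 1 G (w / (s z * s z)).
Proof.
move=> zI; have /lt0r_neq0 sz := s_gt0 zI.
refine (is_derive_eq (derM (derN (dr z)) (derV sz (ds z))) _).
by rewrite -(wE z); field; rewrite sz.
Qed.

(** The derivative of [- r / s] is [w / s ^ 2], as the Wronskian [w] is constant;
    the term [s'' = - k s] is all that survives in the Schwarzian derivative. *)
Lemma ratio_uniformizer : uniformizer (cst (2 * k)) G.
Proof.
have oI := @open_oo R 0 1.
have sn (z : R) : z \in `]0, 1[ -> s z != 0 by move=> /s_gt0/lt0r_neq0.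
split.
- have [cr _] := oscillator_Cn 3 dr dr1; have [cs _] := oscillator_Cn 3 ds ds1.
  exact: (Cn_onM oI (Cn_onN oI cr) (Cn_onV oI sn cs)).
- move=> z zI; rewrite (der_derive1 (dG zI)) divr_gt0// mulr_gt0// s_gt0//.
- move=> z zI; have sz := sn z zI.
  rewrite (@schwarzian_jet3 _ `]0, 1[ _ (fun z => w / (s z * s z))
    (fun z => - 2 * w * s1 z / (s z * s z * s z))
    (fun z => 2 * w * k / (s z * s z) +
       6 * w * s1 z ^+ 2 / (s z * s z * s z * s z)))//.
    by rewrite /cst; field; rewrite sz lt0r_neq0.
  move=> y yI; have sy := sn y yI; split; first exact: dG.
    refine (is_derive_eq (derM (derC w y)
      (derV (f := fun y => s y * s y) (mulf_neq0 sy sy) (derM (ds y) (ds y)))) _).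
    by field; rewrite sy.
  refine (is_derive_eq (derM (derM (derC (- 2 * w) y) (ds1 y))
    (derV (f := fun y => s y * s y * s y) (mulf_neq0 (mulf_neq0 sy sy) sy)
      (derM (derM (ds y) (ds y)) (ds y)))) _).
  by field; rewrite sy.
- move=> K; pose m := `|K| + 1.
  have m0 : 0 < m by rewrite ltr_wpDl.
  have e0 : 0 < r 0 / (2 * m) by rewrite divr_gt0// mulr_gt0.
  have nr : \forall z \near (0 : R)^'+, r 0 / 2 < r z.
    have : r z @[z --> (0 : R)^'+] --> r 0.
      exact: cvg_at_right_filter (der_continuous (dr 0)).
    by move=> /cvgr_gt; apply; rewrite ltr_pdivrMr// ltr_pMr// ltr1n.
  have ns : \forall z \near (0 : R)^'+, s z < r 0 / (2 * m).
    have : s z @[z --> (0 : R)^'+] --> s 0.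
      exact: cvg_at_right_filter (der_continuous (ds 0)).
    by rewrite s0 => /cvgr_lt; apply.
  near=> z.
  have zI : z \in `]0, 1[ by rewrite in_itv/=; apply/andP; split.
  have h1 : r 0 / 2 < r z by near: z.
  have h2 : s z < r 0 / (2 * m) by near: z.
  have sz := s_gt0 zI.
  rewrite /G ltr_pdivrMr//.
  have h3 : s z * m < r 0 / 2.
    by rewrite -ltr_pdivlMr// -mulrA -invfM.
  have h4 : - m * s z < K * s z.
    by rewrite ltr_pM2r// /m ltrNl; have := ler_norm (- K); rewrite normrN; lra.
  lra.
Unshelve. all: by end_near.
Qed.

(** [- r / s] takes the value [y] where the solution [r + y * s] vanishes; that
    one is positive at 0 and negative at 1. *)
Lemma ratio_surj (y : R) : r 1 + y * s 1 < 0 ->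
  exists2 z, z \in `]0, 1[ & G z = y.
Proof.
move=> y1; pose h z := r z + y * s z.
have ch : {within `[0, 1], continuous h}.
  apply: continuous_subspaceT => z.
  by exact: der_continuous (derD (dr z) (derM (derC y z) (ds z))).
have h0 : 0 < h 0 by rewrite /h s0 mulr0 addr0.
have h1 : h 1 < 0 by [].
have [||z] := @IVT _ h 0 1 0 _ ch; first exact: ler01.
  by rewrite ge_min le_max (ltW h0) (ltW h1) orbT.
rewrite in_itv/= => /andP[z0 z1] hz.
have zI : z \in `]0, 1[.
  rewrite in_itv/= !lt_neqAle z0 z1 !andbT eq_sym; apply/andP; split.
    by apply/eqP => e; move: h0 hz; rewrite e => + hz; rewrite hz ltxx.
  by apply/eqP => e; move: h1 hz; rewrite e => + hz; rewrite hz ltxx.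
exists z => //; have /lt0r_neq0 sz := s_gt0 zI.
rewrite /G; have -> : r z = - (y * s z) by move: hz; rewrite /h; lra.
by rewrite opprK mulfK.
Qed.

End ratio.

Lemma unif_onto_pinv (U G : R -> R) (J : set R) : uniformizer U G -> open J ->
  (forall z : R, z \in `]0, 1[ -> J (G z)) ->
  (forall y, J y -> exists2 z, z \in `]0, 1[ & G z = y) ->
  unif_onto U G J ('pinv_(fun=> 0) `]0, 1[ G).
Proof.
move=> uG oJ GJ sG.
have sG' : set_surj `]0, 1[ J G by move=> y /sG[z zI <-]; exists z.
split=> // y Jy.
  by apply: (surjpinv_image_sub (dflt := fun=> 0) sG'); exists y.
have E : {in J, cancel ('pinv_(fun=> 0) `]0, 1[ G) G} by exact: surjpK.
by apply: E; rewrite inE.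
Qed.

Definition neg_axis : set R := [set y | y < 0].

(** The boundary point 0 of the half-line must be fixed. *)
Lemma preserves_neg_axis (a b : R) : 0 < a -> preserves neg_axis a b <-> b = 0.
Proof.
move=> a0; split=> [P|-> y]; last first.
  by rewrite /neg_axis/= addr0 pmulr_rlt0.
have := P (- b / (2 * a)); have := P (- b / a).
have e1 : a * (- b / (2 * a)) + b = b / 2 by field; rewrite lt0r_neq0.
have e2 : a * (- b / a) + b = 0 by field; rewrite lt0r_neq0.
rewrite /neg_axis/= e1 e2 ltxx => -[h1 _] [_ h2].
have [b0|b0|//] := ltgtP b 0.
  have : - b / (2 * a) < 0 by apply: h2; lra.
  by rewrite pmulr_llt0 ?invr_gt0 ?mulr_gt0//; lra.
by have // : false by apply: h1; rewrite mulNr oppr_lt0 divr_gt0.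
Qed.

Lemma lie_dim_neg_axis (U G H : R -> R) : unif_onto U G neg_axis H ->
  has_lie_dim (isotropy U) 1.
Proof.
move=> uo; apply: (@isotropy_lie_dim _ _ _ _ _ uo 1 0 0 0 (const_mx 1) 0).
- by move=> p; apply/rowP => i; rewrite !mxE ord1 mulr0 addr0 mulr1.
- move=> x y /(preserves_neg_axis _ (expR_gt0 x)) ->.
  by rewrite !mxE mulr1 mulr0 addr0 mul0r.
- by move=> p; rewrite mul0r; apply/preserves_neg_axis => //; exact: expR_gt0.
Qed.

Lemma lie_dim_setT (U G H : R -> R) : unif_onto U G setT H ->
  has_lie_dim (isotropy U) 2.
Proof.
move=> uo; apply: (@isotropy_lie_dim _ _ _ _ _ uo 2 0 1 1 (delta_mx 0 0) (delta_mx 0 1)).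
- move=> p; rewrite mul1r [RHS]row_sum_delta big_ord_recl big_ord1.
  by congr (_ + p 0 _ *: delta_mx 0 _); apply/val_inj.
- by move=> x y _; rewrite !mxE/= !mulr1 !mulr0 addr0 add0r mul1r.
- by [].
Qed.

(** The second solution is the reflection [s (1 - z)] of the first.  The ratio
    tends to 0 at 1, so its range is the negative half-line. *)
Lemma lie_dim_oscillator (k : R) (s s1 : R -> R) :
  (forall x : R, is_derive x 1 s (s1 x)) ->
  (forall x : R, is_derive x 1 s1 (- k * s x)) ->
  s 0 = 0 -> 0 < s1 0 -> (forall x : R, 0 < x <= 1 -> 0 < s x) ->
  has_lie_dim (isotropy (cst (2 * k))) 1.
Proof.
move=> ds ds1 s0 s10 s_gt0.
have d1 (x : R) : is_derive x 1 (fun y => 1 - y) (-1).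
  by refine (is_derive_eq (derB (derC 1 x) (derI x)) _); rewrite sub0r.
pose r z := s (1 - z); pose r1 z := - s1 (1 - z).
have dr (x : R) : is_derive x 1 r (r1 x).
  by refine (is_derive_eq (der_comp (ds _) (d1 x)) _); rewrite mulrN1.
have dr1 (x : R) : is_derive x 1 r1 (- k * r x).
  by refine (is_derive_eq (derN (der_comp (ds1 _) (d1 x))) _); rewrite mulrN1 opprK.
pose w := s 1 * s1 0.
have w0 : 0 < w by rewrite mulr_gt0// s_gt0// ltr01 lexx.
have wE (x : R) : r x * s1 x - r1 x * s x = w.
  have <- : r 0 * s1 0 - r1 0 * s 0 = w by rewrite s0 mulr0 subr0 /r subr0.
  apply: (@is_derive_0_is_cst _ (fun x => r x * s1 x - r1 x * s x)) => y.
  refine (is_derive_eq (derB (derM (dr y) (ds1 y)) (derM (dr1 y) (ds y))) _).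
  by ring.
have sI (x : R) : x \in `]0, 1[ -> 0 < s x.
  by rewrite in_itv/= => /andP[x0 x1]; rewrite s_gt0// x0 ltW.
have r0 : 0 < r 0 by rewrite /r subr0 s_gt0// ltr01 lexx.
have uG := ratio_uniformizer dr dr1 ds ds1 wE w0 sI s0 r0.
apply: (@lie_dim_neg_axis _ _ _ (unif_onto_pinv uG _ _ _)).
- exact: open_lt.
- move=> z zI; rewrite /neg_axis/= mulNr oppr_lt0 divr_gt0 ?sI//.
  by move: zI; rewrite !in_itv/= => /andP[? ?]; apply/andP; split; lra.
- move=> y y0; apply: (ratio_surj dr ds sI s0 r0).
  by rewrite /r subrr s0 add0r nmulr_rlt0// s_gt0// ltr01 lexx.
Qed.

(** The solution vanishing at 0 is a hyperbolic sine, a sine or the identity; in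
    the second case it has no zero in ]0, 1] because its frequency is less than
    [pi]. *)
Lemma lie_dim_subcritical (c : R) : c < 2 * pi ^+ 2 ->
  has_lie_dim (isotropy (cst c)) 1.
Proof.
move=> cpi; have -> : c = 2 * (c / 2) by field.
have [c0|c0|->] := ltgtP c 0.
- pose b := Num.sqrt (- (c / 2)).
  have b0 : 0 < b by rewrite sqrtr_gt0; lra.
  have b2 : b * b = - (c / 2) by rewrite -expr2 sqr_sqrtr; lra.
  have dE (a x : R) : is_derive x 1 (fun y => expR (a * y)) (a * expR (a * x)).
    refine (is_derive_eq (der_comp (is_derive_expR _) (derM (derC a x) (derI x))) _).
    by rewrite mul0r add0r mulr1 mulrC.
  apply: (@lie_dim_oscillator _ (fun x => expR (b * x) - expR (- b * x))
    (fun x => b * expR (b * x) + b * expR (- b * x))).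
  + move=> x; refine (is_derive_eq (derB (dE b x) (dE (- b) x)) _); ring.
  + move=> x; refine (is_derive_eq (derD (derM (derC b x) (dE b x))
      (derM (derC b x) (dE (- b) x))) _).
    by rewrite -b2; ring.
  + by rewrite !mulr0 subrr.
  + by rewrite !mulr0 expR0 mulr1 addr_gt0.
  + move=> x /andP[x0 _]; rewrite subr_gt0 ltr_expR mulNr.
    by rewrite gtrN// mulr_gt0.
- pose a := Num.sqrt (c / 2).
  have a0 : 0 < a by rewrite sqrtr_gt0; lra.
  have a2 : a * a = c / 2 by rewrite -expr2 sqr_sqrtr; lra.
  have api : a < pi.
    rewrite -(@ltr_pXn2r _ 2)// ?nnegrE ?ltW ?pi_gt0//.
    by rewrite expr2 a2; lra.
  have da (x : R) : is_derive x 1 (fun y => a * y) a.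
    by refine (is_derive_eq (derM (derC a x) (derI x)) _); rewrite mul0r add0r mulr1.
  apply: (@lie_dim_oscillator _ (fun x => sin (a * x)) (fun x => a * cos (a * x))).
  + move=> x; refine (is_derive_eq (der_comp (is_derive_sin _) (da x)) _).
    by rewrite mulrC.
  + move=> x; refine (is_derive_eq (derM (derC a x)
      (der_comp (is_derive_cos _) (da x))) _).
    by rewrite -a2; ring.
  + by rewrite mulr0 sin0.
  + by rewrite mulr0 cos0 mulr1.
  + move=> x /andP[x0 x1]; apply: sin_gt0_pi; rewrite mulr_gt0//=.
    by apply: le_lt_trans api; rewrite ger_pMr.
- apply: (@lie_dim_oscillator _ id (fun=> 1)).
  + by move=> x; refine (is_derive_eq (derC 1 x) _); rewrite mul0r oppr0 mul0r.
  + by [].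
  + exact: ltr01.
  + by move=> x /andP[].
Qed.

(** Sturm comparison: if [c > 2 pi ^ 2], a solution of the same equation has two
    consecutive zeros [e] and [e + pi / a] inside ]0, 1[, where its Wronskian with
    a positive solution has opposite signs; but the Wronskian is constant. *)
Lemma prob_cone_cst_le (c : R) : prob_cone (cst c) -> c <= 2 * pi ^+ 2.
Proof.
move=> [_ [psi [dpsi psiP]]]; rewrite leNgt; apply/negP => cpi.
have p0 := @pi_gt0 R.
have p20 : 0 < pi ^+ 2 :> R by rewrite exprn_gt0.
pose a := Num.sqrt (c / 2).
have a0 : 0 < a by rewrite sqrtr_gt0; lra.
have a2 : a * a = c / 2 by rewrite -expr2 sqr_sqrtr; lra.
have api : pi < a.
  rewrite -(@ltr_pXn2r _ 2)// ?nnegrE ?ltW//.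
  by rewrite [X in _ < X]expr2 a2; lra.
have pa1 : pi / a < 1 by rewrite ltr_pdivrMr// mul1r.
have pa0 : 0 < pi / a by rewrite divr_gt0.
(* centres in ]0, 1[ the interval of length [pi / a] between the zeros *)
pose e := (1 - pi / a) / 2.
have eI : e \in `]0, 1[ by rewrite in_itv/=; apply/andP; split; rewrite /e; lra.
have eI' : e + pi / a \in `]0, 1[.
  by rewrite in_itv/=; apply/andP; split; rewrite /e; lra.
pose psi1 : R -> R := derive1 psi.
have d0 (z : R) : z \in `]0, 1[ -> is_derive z 1 psi (psi1 z).
  by move=> zI; apply: der_ex; exact: (dpsi 0%N).
have d1 (z : R) : z \in `]0, 1[ -> is_derive z 1 psi1 (- (c / 2) * psi z).
  move=> zI; have -> : - (c / 2) * psi z = derive1 psi1 z.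
    by have [_] := psiP z zI; rewrite derive1nS derive1n1 /cst -/psi1; lra.
  by apply: der_ex; exact: (dpsi 1%N).
have da (x : R) : is_derive x 1 (fun y => a * (y - e)) a.
  refine (is_derive_eq (derM (derC a x) (derB (derI x) (derC e x))) _).
  by rewrite mul0r add0r subr0 mulr1.
pose W z := psi1 z * sin (a * (z - e)) - psi z * (a * cos (a * (z - e))).
have dW (z : R) : z \in `]0, 1[ -> is_derive z 1 W 0.
  move=> zI; refine (is_derive_eq (derB (derM (d1 z zI)
    (der_comp (is_derive_sin _) (da z))) (derM (d0 z zI) (derM (derC a z)
    (der_comp (is_derive_cos _) (da z))))) _).
  by rewrite -a2; ring.
have := der0_cst dW eI eI'; rewrite /W subrr mulr0 sin0 cos0.
have -> : a * (e + pi / a - e) = pi by field; rewrite lt0r_neq0.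
rewrite sinpi cospi.
have [q1 _] := psiP _ eI; have [q2 _] := psiP _ eI'.
have := mulr_gt0 q1 a0; have := mulr_gt0 q2 a0.
lra.
Qed.

Lemma prob_cone_critical : prob_cone (cst (2 * pi ^+ 2 : R)).
Proof.
have oI := @open_oo R 0 1.
split; first by move=> z _; exact: cvg_cst.
have da (x : R) : is_derive x 1 (fun y : R => pi * y) pi.
  by refine (is_derive_eq (derM (derC pi x) (derI x)) _); rewrite mul0r add0r mulr1.
have d0 (x : R) : is_derive x 1 (fun y => sin (pi * y)) (pi * cos (pi * x)).
  by refine (is_derive_eq (der_comp (is_derive_sin _) (da x)) _); rewrite mulrC.
have d1 (x : R) : is_derive x 1 (fun y : R => pi * cos (pi * y))
    (- pi ^+ 2 * sin (pi * x)).
  refine (is_derive_eq (derM (derC pi x) (der_comp (is_derive_cos _) (da x))) _).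
  by ring.
have [cs _] := oscillator_Cn 2 d0 d1.
exists (fun z => sin (pi * z)); split; first exact: cs.1.
move=> z; rewrite in_itv/= => /andP[z0 z1]; split.
  by apply: sin_gt0_pi; rewrite mulr_gt0 ?pi_gt0//= gtr_pMr ?pi_gt0.
have -> : derive1 (fun z : R => sin (pi * z)) = (fun z => pi * cos (pi * z)).
  by apply/funext => x; exact: der_derive1.
by rewrite (der_derive1 (d1 z)) /cst; field.
Qed.

End constant_potentials.

(** * The threshold potential *)

Section critical.
Context {R : realType}.
Implicit Types z : R.

Let pi0 : 0 < pi :> R := pi_gt0 R.
Let pin0 : pi != 0 :> R. Proof. exact: lt0r_neq0. Qed.

Lemma sin_pi_gt0 z : z \in `]0, 1[ -> 0 < sin (pi * z).
Proof.
rewrite in_itv/= => /andP[z0 z1].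
by apply: sin_gt0_pi; rewrite mulr_gt0//= gtr_pMr.
Qed.

Lemma der_lin (a x : R) : is_derive x 1 (fun y : R => a * y) a.
Proof.
by refine (is_derive_eq (derM (derC a x) (derI x)) _); rewrite mul0r add0r mulr1.
Qed.

Lemma der_sin_lin (a x : R) :
  is_derive x 1 (fun y : R => sin (a * y)) (a * cos (a * x)).
Proof.
by refine (is_derive_eq (der_comp (is_derive_sin _) (der_lin a x)) _); rewrite mulrC.
Qed.

Lemma der_cos_lin (a x : R) :
  is_derive x 1 (fun y : R => cos (a * y)) (- (a * sin (a * x))).
Proof.
refine (is_derive_eq (der_comp (is_derive_cos _) (der_lin a x)) _).
by rewrite mulNr mulrC.
Qed.

Lemma unif_coordE z : unif_coord z = - cos (pi * z) / sin (pi * z).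
Proof.
rewrite /unif_coord /tan.
have -> : pi * (z - 1 / 2) = pi * z - pi / 2 by field.
by rewrite sinBpihalf cosBpihalf.
Qed.

Definition unif_coord_inv : R -> R := 'pinv_(fun=> 0) `]0, 1[ unif_coord.

Lemma unif_coord_onto :
  unif_onto (cst (2 * pi ^+ 2)) unif_coord setT unif_coord_inv.
Proof.
have VE : unif_coord = (fun z : R => - cos (pi * z) / sin (pi * z)).
  by apply/funext => z; exact: unif_coordE.
pose s1 (z : R) := pi * cos (pi * z); pose r1 (z : R) := - (pi * sin (pi * z)).
have ds (x : R) : is_derive x 1 (fun z => sin (pi * z)) (s1 x).
  exact: der_sin_lin.
have dr (x : R) : is_derive x 1 (fun z => cos (pi * z)) (r1 x).
  exact: der_cos_lin.
have ds1 (x : R) : is_derive x 1 s1 (- pi ^+ 2 * sin (pi * x)).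
  by refine (is_derive_eq (derM (derC pi x) (der_cos_lin pi x)) _); ring.
have dr1 (x : R) : is_derive x 1 r1 (- pi ^+ 2 * cos (pi * x)).
  by refine (is_derive_eq (derN (derM (derC pi x) (der_sin_lin pi x))) _); ring.
have wE (x : R) : cos (pi * x) * s1 x - r1 x * sin (pi * x) = pi.
  have := cos2Dsin2 (pi * x); rewrite /s1 /r1 => h.
  by rewrite -[RHS]mulr1 -h; ring.
have s0 : sin (pi * 0 : R) = 0 by rewrite mulr0 sin0.
have r0 : 0 < cos (pi * 0 : R) by rewrite mulr0 cos0.
apply: unif_onto_pinv => //.
- by rewrite VE; exact: (ratio_uniformizer dr dr1 ds ds1 wE pi0 sin_pi_gt0 s0 r0).
- exact: openT.
- move=> y _; rewrite VE; apply: (ratio_surj dr ds sin_pi_gt0 s0 r0).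
  by rewrite mulr1 cospi sinpi mulr0 addr0 oppr_lt0.
Qed.

Lemma unif_coord_der z : z \in `]0, 1[ ->
  is_derive z 1 unif_coord (pi / sin (pi * z) ^+ 2).
Proof.
move=> zI; have /lt0r_neq0 sz := sin_pi_gt0 zI.
have -> : unif_coord = (fun z : R => - cos (pi * z) / sin (pi * z)).
  by apply/funext => y; exact: unif_coordE.
refine (is_derive_eq (derM (derN (der_cos_lin pi z)) (derV sz (der_sin_lin pi z))) _).
rewrite -[X in _ = X / _]mulr1 -(cos2Dsin2 (pi * z)).
by field; rewrite sz.
Qed.

(** * The formal isotropy algebra *)

Lemma critical_formalE : formal_isotropy (cst (2 * pi ^+ 2) : R -> R) =
  [set xi | [/\ derivable_n 3 `]0, 1[ xi,
      forall z, z \in `]0, 1[ -> derive1n 3 xi z + 4 * pi ^+ 2 * derive1 xi z = 0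
    & vanish_ends xi]].
Proof.
have e (xi : R -> R) z : derive1n 3 xi z + 2 * cst (2 * pi ^+ 2 : R) z * derive1 xi z
    + derive1 (cst (2 * pi ^+ 2)) z * xi z
    = derive1n 3 xi z + 4 * pi ^+ 2 * derive1 xi z.
  by rewrite derive1_cst mul0r addr0 /cst; congr (_ + _ * _); ring.
by apply/seteqP; split=> xi [h1 h2 h3]; split=> // z /h2; rewrite e.
Qed.

Let w : R := 2 * pi.
Let w0 : w != 0. Proof. by rewrite mulf_neq0// pnatr_eq0. Qed.

Let trig (a b z : R) := a * (sin (w * z) / w) + b * ((1 - cos (w * z)) / w).

Let trig_jet (a b : R) : jet3 setT (trig a b)
  (fun z => a * cos (w * z) + b * sin (w * z))
  (fun z => w * (b * cos (w * z) - a * sin (w * z)))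
  (fun z => - (w * w * (a * cos (w * z) + b * sin (w * z)))).
Proof.
move=> z _; have ds := der_sin_lin w z; have dc := der_cos_lin w z; split.
- refine (is_derive_eq (derD (derM (derC a z) (derM ds (derC w^-1 z)))
    (derM (derC b z) (derM (derB (derC 1 z) dc) (derC w^-1 z)))) _).
  by field.
- by refine (is_derive_eq (derD (derM (derC a z) dc) (derM (derC b z) ds)) _); ring.
- by refine (is_derive_eq (derM (derC w z) (derB (derM (derC b z) dc)
    (derM (derC a z) ds))) _); ring.
Qed.

Let trig0 a b : trig a b 0 = 0.
Proof. by rewrite /trig mulr0 sin0 cos0 subrr !mul0r !mulr0 addr0. Qed.

Let trig1 a b : trig a b 1 = 0.
Proof.
have e : w * 1 = pi *+ 2 by rewrite /w mulr1 mulr_natl.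
by rewrite /trig e sin2pi cos2pi subrr !mul0r !mulr0 addr0.
Qed.

Let trig_cvg0 a b : trig a b z @[z --> 0^'+] --> 0.
Proof.
rewrite -[X in _ --> X](trig0 a b); apply: cvg_at_right_filter.
by case: (trig_jet a b (x := 0) I) => /der_continuous.
Qed.

Let trig_cvg1 a b : trig a b z @[z --> 1^'-] --> 0.
Proof.
rewrite -[X in _ --> X](trig1 a b); apply: cvg_at_left_filter.
by case: (trig_jet a b (x := 1) I) => /der_continuous.
Qed.

Lemma near_right0 (P : R -> Prop) : (forall z, z \in `]0, 1[ -> P z) ->
  \forall z \near 0^'+, P z.
Proof.
move=> h; near=> z; apply: h; rewrite in_itv/=; apply/andP; split => //.
Unshelve. all: by end_near.
Qed.

Lemma near_left1 (P : R -> Prop) : (forall z, z \in `]0, 1[ -> P z) ->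
  \forall z \near 1^'-, P z.
Proof.
move=> h; near=> z; apply: h; rewrite in_itv/=; apply/andP; split => //.
Unshelve. all: by end_near.
Qed.

(** With [w = 2 pi], the equation is [xi''' = - w ^ 2 xi'].  Its first integrals
    [A], [B] (amplitudes of the oscillator [xi']) and [C] determine [xi] up to
    the constant term, which the limit at 0 forces to be 0. *)
Lemma critical_formal_span : formal_isotropy (cst (2 * pi ^+ 2) : R -> R) =
  field_span (fun z => sin (2 * pi * z) / (2 * pi))
             (fun z => (1 - cos (2 * pi * z)) / (2 * pi)).
Proof.
have oI := @open_oo R 0 1.
rewrite critical_formalE; apply/seteqP; split=> xi; last first.
  move=> [a [b xiE]].
  have {}xiE z : z \in `]0, 1[ -> trig a b z = xi z by move=> /xiE.
  have jx : jet3 `]0, 1[ xi (fun z => a * cos (w * z) + b * sin (w * z))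
      (fun z => w * (b * cos (w * z) - a * sin (w * z)))
      (fun z => - (w * w * (a * cos (w * z) + b * sin (w * z)))).
    move=> z zI; have [h1 h2 h3] := trig_jet a b (x := z) I; split=> //.
    exact: der_eq_on oI zI xiE h1.
  split; first exact: jet3_derivable_n jx.
    move=> z zI; have [e1 _ e3] := jet3E oI jx zI.
    by rewrite -derive1n1 e1 e3 /w; ring.
  split.
    apply: cvg_trans (trig_cvg0 a b).
    by apply: near_eq_cvg; apply: near_right0.
  apply: cvg_trans (trig_cvg1 a b).
  by apply: near_eq_cvg; apply: near_left1.
move=> [dxi ode [v0 _]].
have := derivable_n_jet3 dxi.
set x1 : R -> R := derive1n 1 xi; set x2 : R -> R := derive1n 2 xi.
set x3 : R -> R := derive1n 3 xi => jx.
have x3E z : z \in `]0, 1[ -> x3 z = - (w * w) * x1 z.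
  move=> zI; have := ode z zI; rewrite -derive1n1 -/x1 -/x3 => h.
  by apply/eqP; rewrite -subr_eq0; apply/eqP; rewrite -[RHS]h /w; ring.
have hI : 2^-1 \in `]0, (1 : R)[ by rewrite in_itv/=; apply/andP; split; lra.
pose A z := x1 z * cos (w * z) - x2 z * sin (w * z) / w.
pose B z := x1 z * sin (w * z) + x2 z * cos (w * z) / w.
pose C z := x2 z + w * w * xi z.
have cA z : z \in `]0, 1[ -> A z = A 2^-1.
  move=> zI; apply: (der0_cst _ zI hI) => y yI; have [_ d1 d2] := jx y yI.
  refine (is_derive_eq (derB (derM d1 (der_cos_lin w y))
    (derM (derM d2 (der_sin_lin w y)) (derC w^-1 y))) _).
  by rewrite -/(x1 y) -/(x2 y) -/(x3 y) x3E//; field.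
have cB z : z \in `]0, 1[ -> B z = B 2^-1.
  move=> zI; apply: (der0_cst _ zI hI) => y yI; have [_ d1 d2] := jx y yI.
  refine (is_derive_eq (derD (derM d1 (der_sin_lin w y))
    (derM (derM d2 (der_cos_lin w y)) (derC w^-1 y))) _).
  by rewrite -/(x1 y) -/(x2 y) -/(x3 y) x3E//; field.
have cC z : z \in `]0, 1[ -> C z = C 2^-1.
  move=> zI; apply: (der0_cst _ zI hI) => y yI; have [d0 _ d2] := jx y yI.
  refine (is_derive_eq (derD d2 (derM (derC (w * w) y) d0)) _).
  by rewrite -/(x1 y) -/(x3 y) x3E//; ring.
move: (A 2^-1) (B 2^-1) (C 2^-1) cA cB cC => a b c cA cB cC.
have x2E z : z \in `]0, 1[ -> x2 z = w * (b * cos (w * z) - a * sin (w * z)).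
  move=> zI; rewrite -(cA z zI) -(cB z zI) /A /B.
  rewrite -[LHS]mulr1 -(cos2Dsin2 (w * z)); by field.
have xiE z : z \in `]0, 1[ -> xi z = trig a b z + (c / (w * w) - b / w).
  move=> zI; have := cC z zI; rewrite /C x2E// => <-.
  by rewrite /trig; field.
have k0 : c / (w * w) - b / w = 0.
  have l : trig a b z + (c / (w * w) - b / w) @[z --> 0^'+] -->
      0 + (c / (w * w) - b / w).
    by apply: cvgD (cvg_cst _); exact: trig_cvg0.
  have {}l : xi z @[z --> 0^'+] --> 0 + (c / (w * w) - b / w).
    apply: cvg_trans l; apply: near_eq_cvg; apply: near_right0 => z zI.
    by rewrite xiE.
  have := cvg_unique _ l v0; rewrite add0r; apply; exact: Rhausdorff.
by exists a, b => z zI; rewrite xiE// k0 addr0.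
Qed.

(** * Drift fields *)

Lemma drift_ftc (v F : R -> R) z : 0 < z -> continuous v ->
  (forall x : R, is_derive x 1 F (v x)) -> drift v z = F z - F 0 - z.
Proof.
move=> z0 cv dF; rewrite /drift /Rintegral (@continuous_FTC2 _ v F 0 z)//.
- by apply: continuous_subspaceT.
- split.
  + by move=> x _; case: (dF x).
  + by apply: cvg_at_right_filter; exact: der_continuous (dF 0).
  + by apply: cvg_at_left_filter; exact: der_continuous (dF z).
- by move=> x _; exact: der_derive1.
Qed.

Lemma sin_sqr_double x : 2 * sin x ^+ 2 = 1 - cos (2 * x) :> R.
Proof.
have -> : 2 * x = x *+ 2 by rewrite mulr_natl.
by rewrite cos_mulr2n cos2sin2 -mulr_natl; ring.
Qed.

Lemma drift_canonical z : z \in `]0, 1[ ->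
  drift canonical_kernel z = - (sin (2 * pi * z) / (2 * pi)).
Proof.
rewrite in_itv/= => /andP[z0 _].
have cv : continuous (@canonical_kernel R).
  by move=> x; exact: (der_continuous (derM (derC 2 x) (derX2 (der_sin_lin pi x)))).
have dF (x : R) : is_derive x 1 (fun z => z - sin (w * z) * w^-1) (canonical_kernel x).
  refine (is_derive_eq (derB (derI x) (derM (der_sin_lin w x) (derC w^-1 x))) _).
  rewrite /canonical_kernel sin_sqr_double.
  have -> : 2 * (pi * x) = w * x by rewrite /w mulrA.
  by field.
have := drift_ftc z0 cv dF.
by rewrite mulr0 sin0 -/w => ->; ring.
Qed.

Lemma drift_quarter z : z \in `]0, 1[ ->
  drift quarter_kernel z = (1 - cos (2 * pi * z)) / (2 * pi).
Proof.
rewrite in_itv/= => /andP[z0 _].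
have dv (x : R) : is_derive x 1 (fun z : R => pi * (z + 1 / 4)) pi.
  refine (is_derive_eq (derM (derC pi x) (derD (derI x) (derC (1 / 4) x))) _).
  by rewrite mul0r add0r addr0 mulr1.
have cv : continuous (@quarter_kernel R).
  move=> x; exact: (der_continuous (derM (derC 2 x)
    (derX2 (der_comp (is_derive_sin _) (dv x))))).
have dF (x : R) : is_derive x 1 (fun z => z - cos (w * z) * w^-1) (quarter_kernel x).
  refine (is_derive_eq (derB (derI x) (derM (der_cos_lin w x) (derC w^-1 x))) _).
  rewrite /quarter_kernel sin_sqr_double.
  have -> : 2 * (pi * (x + 1 / 4)) = w * x + pi / 2 by rewrite /w; field.
  by rewrite cosDpihalf; field.
have := drift_ftc z0 cv dF.
by rewrite mulr0 cos0 -/w => ->; ring.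
Qed.

Lemma critical_drift_span : formal_isotropy (cst (2 * pi ^+ 2) : R -> R) =
  field_span (drift canonical_kernel) (drift quarter_kernel).
Proof.
rewrite critical_formal_span; apply/seteqP; split=> xi [a [b xiE]];
  exists (- a), b => z zI; rewrite xiE// drift_canonical// drift_quarter//;
  by ring.
Qed.

(** The factor [pi / sin (pi * z) ^ 2] is the derivative of the coordinate, so
    this is the expression of the field in that coordinate. *)
Lemma drift_can_dilation z : z \in `]0, 1[ ->
  pi / sin (pi * z) ^+ 2 * drift canonical_kernel z = unif_coord z.
Proof.
move=> zI; have /lt0r_neq0 sz := sin_pi_gt0 zI.
rewrite drift_canonical// unif_coordE.
have -> : 2 * pi * z = (pi * z) *+ 2 by rewrite mulr2n; ring.
rewrite sin_mulr2n mulr2n; have p0 := pin0.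
move: (sin (pi * z)) (cos (pi * z)) sz => s c s0; move: (pi : R) p0 => p p0.
by field; apply/andP; split.
Qed.

Lemma drift_quarter_translation z : z \in `]0, 1[ ->
  pi / sin (pi * z) ^+ 2 * drift quarter_kernel z = 1.
Proof.
move=> zI; have /lt0r_neq0 sz := sin_pi_gt0 zI.
rewrite drift_quarter// -[2 * pi * z]mulrA -sin_sqr_double.
have p0 := pin0; move: (sin (pi * z)) sz => s s0; move: (pi : R) p0 => p p0.
by field; apply/andP; split.
Qed.

(** * Flows *)

Let H : R -> R := unif_coord_inv.
Let uo := unif_coord_onto.
Let PT (a b : R) : preserves [set: R] a b. Proof. by []. Qed.

(** In the uniformizing coordinate the field is [V' = al * V + be]; its flow is
    [V |-> expR (al * t) * V + T t], where [T] solves the same equation from 0. *)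
Lemma affine_flow (al be : R) (T : R -> R) (xi : R -> R) :
  (forall z, z \in `]0, 1[ ->
     xi z = al * drift canonical_kernel z + be * drift quarter_kernel z) ->
  T 0 = 0 -> (forall s t : R, T (s + t) = expR (al * s) * T t + T s) ->
  (forall t : R, is_derive t 1 T (al * T t + be)) ->
  is_flow xi (fun t => affine_dist unif_coord H (expR (al * t)) (T t)).
Proof.
move=> xiE T0 TD dT.
have d t : distortion (affine_dist unif_coord H (expR (al * t)) (T t)).
  by apply: (affine_dist_distortion uo) => //; exact: expR_gt0.
split.
- by move=> z zI; rewrite mulr0 expR0 T0 (affine_dist_id uo).
- move=> s t z zI; rewrite mulrDr expRD TD.
  by rewrite -[RHS]/((affine_dist _ _ _ _ \o _) z) (affine_dist_comp uo).
- by move=> t z zI; apply: (affine_dist_oo uo).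
- move=> t z zI; have yI := affine_dist_oo uo (PT (expR (al * t)) (T t)) zI.
  set y := affine_dist _ _ _ _ _ in yI *.
  have Vy : unif_coord y = expR (al * t) * unif_coord z + T t.
    exact: (affine_distE uo).
  have E : (fun s => affine_dist unif_coord H (expR (al * s)) (T s) z) =
      (fun s => H (expR (al * s) * unif_coord z + T s)).
    by apply/funext => s; rewrite /affine_dist zI.
  rewrite E.
  have dH := uo_der uo (y := unif_coord y) I.
  rewrite (uo_HG uo yI) (der_derive1 (unif_coord_der yI)) in dH.
  rewrite Vy in dH.
  have dw : is_derive t 1 (fun s => expR (al * s) * unif_coord z + T s)
      (al * unif_coord y + be).
    refine (is_derive_eq (derD (derM (der_comp (is_derive_expR _)
      (der_lin al t)) (derC (unif_coord z) t)) (dT t)) _).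
    by rewrite Vy; ring.
  refine (is_derive_eq
    (der_comp (g := fun s => expR (al * s) * unif_coord z + T s) dH dw) _).
  rewrite xiE// -[X in _ * (al * X + _)](drift_can_dilation yI).
  rewrite -[X in _ * (_ + X)]mulr1 -(drift_quarter_translation yI).
  have /lt0r_neq0 sy := sin_pi_gt0 yI; have p0 := pin0.
  move: (drift _ y) (drift _ y) (sin _) sy => x1 x2 s s0.
  move: (pi : R) p0 => p p0; by field; apply/andP; split.
- by move=> t; rewrite affine_dist_out// in_itv/= ltxx.
- by move=> t; rewrite affine_dist_out// in_itv/= ltxx andbF.
- by move=> t; exact: dist_continuous.
Qed.

Lemma critical_integrates (xi : R -> R) :
  formal_isotropy (cst (2 * pi ^+ 2)) xi ->
  exists2 phi : R -> R -> R, is_flow xi phi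
    & forall t, isotropy (cst (2 * pi ^+ 2)) (phi t).
Proof.
rewrite critical_drift_span => -[al [be xiE]].
have iso (T : R -> R) t :
    isotropy (cst (2 * pi ^+ 2)) (affine_dist unif_coord H (expR (al * t)) (T t)).
  by apply: (affine_dist_isotropy uo) => //; exact: expR_gt0.
(* the solution [T] is [be * t] if [al = 0], and [be / al * (expR (al * t) - 1)]
   otherwise *)
have [al0|al0] := eqVneq al 0.
  exists (fun t => affine_dist unif_coord H (expR (al * t)) (be * t)) => //.
  apply: affine_flow xiE _ _ _.
  - by rewrite mulr0.
  - by move=> s t; rewrite al0 mul0r expR0; ring.
  - move=> t; refine (is_derive_eq (der_lin be t) _).
    by rewrite al0 mul0r add0r.
exists (fun t => affine_dist unif_coord H (expR (al * t))
  (be / al * (expR (al * t) - 1))); last first.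
  by move=> t; exact: (iso (fun t => be / al * (expR (al * t) - 1))).
apply: affine_flow xiE _ _ _.
- by rewrite mulr0 expR0 subrr mulr0.
- move=> s t; have -> : al * (s + t) = al * s + al * t by ring.
  by rewrite expRD; ring.
- move=> t; refine (is_derive_eq (derM (derC _ t) (derB
    (der_comp (is_derive_expR _) (der_lin al t)) (derC 1 t))) _).
  by field.
Qed.

Lemma canonical_complete : complete_field (drift canonical_kernel : R -> R).
Proof.
have [|phi fphi _] := @critical_integrates (drift canonical_kernel); last by exists phi.
by rewrite critical_drift_span; exists 1, 0 => z _; rewrite mul1r mul0r addr0.
Qed.

Lemma quarter_complete : complete_field (drift quarter_kernel : R -> R).
Proof.
have [|phi fphi _] := @critical_integrates (drift quarter_kernel); last by exists phi.
by rewrite critical_drift_span; exists 0, 1 => z _; rewrite mul1r mul0r add0r.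
Qed.

(** Along any flow of the field, the coordinate solves [V' = V], so that
    [expR (- t) * V] is constant. *)
Lemma canonical_flow_unif (phi : R -> R -> R) (t z : R) :
  is_flow (drift canonical_kernel) phi -> z \in `]0, 1[ ->
  is_derive t (1 : R) (fun s => unif_coord (phi s z)) (unif_coord (phi t z)) /\
  unif_coord (phi t z) = expR t * unif_coord z.
Proof.
move=> fl zI.
have dV s : is_derive s (1 : R) (fun s => unif_coord (phi s z)) (unif_coord (phi s z)).
  have pI := flow_in fl s zI.
  refine (is_derive_eq (der_comp (unif_coord_der pI) (flow_ode fl s zI)) _).
  exact: drift_can_dilation.
split; first exact: dV.
have dE (s : R) : is_derive s 1 (fun s => expR (-1 * s)) (- expR (-1 * s)).
  refine (is_derive_eq (der_comp (is_derive_expR _) (der_lin (-1) s)) _).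
  by rewrite mulrN1.
have dc (s : R) : is_derive s 1 (fun s => unif_coord (phi s z) * expR (-1 * s)) 0.
  by refine (is_derive_eq (derM (dV s) (dE s)) _); ring.
have := is_derive_0_is_cst t 0 dc; rewrite mulr0 expR0 mulr1 (flow_0 fl zI) => <-.
by rewrite mulrCA -expRD mulN1r subrr expR0 mulr1.
Qed.

Lemma quarter_flow_unif (phi : R -> R -> R) (t z : R) :
  is_flow (drift quarter_kernel) phi -> z \in `]0, 1[ ->
  is_derive t (1 : R) (fun s => unif_coord (phi s z)) 1 /\
  unif_coord (phi t z) = unif_coord z + t.
Proof.
move=> fl zI.
have dV s : is_derive s (1 : R) (fun s => unif_coord (phi s z)) 1.
  have pI := flow_in fl s zI.
  refine (is_derive_eq (der_comp (unif_coord_der pI) (flow_ode fl s zI)) _).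
  exact: drift_quarter_translation.
split; first exact: dV.
have dc (s : R) : is_derive s 1 (fun s => unif_coord (phi s z) - s) 0.
  by refine (is_derive_eq (derB (dV s) (derI s)) _); ring.
have := is_derive_0_is_cst t 0 dc; rewrite subr0 (flow_0 fl zI) => <-.
by ring.
Qed.

End critical.

(** * Cauchy laws *)

Section cauchy.
Context {R : realType}.
Variables (m g : R).
Hypothesis g0 : 0 < g.

Let pi0 : 0 < pi :> R := pi_gt0 R.
Let f : R -> R := cauchy_density m g.
Let gn0 : g != 0. Proof. exact: lt0r_neq0. Qed.

Let den_gt0 (y : R) : 0 < y ^+ 2 + g ^+ 2.
Proof. by rewrite ltr_wpDl ?sqr_ge0// exprn_gt0. Qed.

Let f_gt0 x : 0 < f x.
Proof. by rewrite /f /cauchy_density divr_gt0// mulr_gt0. Qed.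

Let der_lin_atan (x : R) : is_derive x 1 (fun t => atan ((t + m) / g) / pi) (f (- x)).
Proof.
refine (is_derive_eq (derM (der_comp (is_derive1_atan _)
  (derM (derD (derI x) (derC m x)) (derC g^-1 x))) (derC pi^-1 x)) _).
rewrite /f /cauchy_density.
have -> : - x - m = - (x + m) by ring.
rewrite sqrrN; have := lt0r_neq0 (den_gt0 (x + m)).
move: (x + m) => y y0.
have h : 1 + (y / g) ^+ 2 = (y ^+ 2 + g ^+ 2) / g ^+ 2 by field.
rewrite h invf_div; have /lt0r_neq0 := pi0; move: (pi : R) => p p0.
by field; rewrite p0 gn0 y0.
Qed.

(** The reflection [t |-> - t] turns the integral over a half-line unbounded
    below into one over a half-line unbounded above, with an explicit primitive. *)
Lemma cauchy_cdf x : law_cdf (cauchy_density m g) x = atan ((x - m) / g) / pi + 1 / 2.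
Proof.
have cf' : continuous f.
  move=> y; have dden : is_derive y 1 (fun y => pi * ((y - m) ^+ 2 + g ^+ 2)) _ :=
    derM (derC pi y) (derD (derX2 (derB (derI y) (derC m y))) (derC (g ^+ 2) y)).
  have n0 : pi * ((y - m) ^+ 2 + g ^+ 2) != 0 by rewrite lt0r_neq0// mulr_gt0.
  exact: (der_continuous (derM (derC g y)
    (derV (f := fun y => pi * ((y - m) ^+ 2 + g ^+ 2)) n0 dden))).
have cf : continuous (f \o -%R).
  move=> y; apply: (@continuous_comp _ _ _ -%R f); last exact: cf'.
  exact: opp_continuous.
rewrite /law_cdf /Rintegral -[x in `]-oo, x]]opprK.
rewrite ge0_integration_by_substitutionNy; last 2 first.
- exact: continuous_subspaceT.
- by move=> y _; exact/ltW/f_gt0.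
have lim : atan ((t + m) / g) / pi @[t --> +oo] --> (1 / 2 : R).
  have -> : 1 / 2 = (pi / 2) / pi :> R.
    by have /lt0r_neq0 := pi0; move: (pi : R) => p p0; field.
  apply: cvgM; last exact: cvg_cst.
  apply: cvg_comp (@cvgy_atan R).
  by apply: gt0_cvgMly; [rewrite invr_gt0|exact: cvg_addrr].
rewrite (@ge0_continuous_FTC2y _ (f \o -%R) (fun t => atan ((t + m) / g) / pi) _ (1 / 2))//=.
- have -> : (- x + m) / g = - ((x - m) / g) by field.
  by rewrite atanN; ring.
- by move=> y _; exact/ltW/f_gt0.
- exact: continuous_subspaceT.
- by apply: cvg_at_right_filter; exact: der_continuous (der_lin_atan _).
- by move=> y _; exact: der_derive1.
Qed.

Lemma cauchy_cdf_oo x : law_cdf (cauchy_density m g) x \in `]0, 1[.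
Proof.
rewrite cauchy_cdf in_itv/=; have := atan_gtNpi2 ((x - m) / g).
have := atan_ltpi2 ((x - m) / g); move: (atan _) => t t1 t2.
apply/andP; split.
  have : - (1 / 2) < t / pi by rewrite ltr_pdivlMr//; lra.
  lra.
have : t / pi < 1 / 2 by rewrite ltr_pdivrMr//; lra.
lra.
Qed.

Lemma unif_coord_cauchy_cdf x :
  unif_coord (law_cdf (cauchy_density m g) x) = (x - m) / g.
Proof.
rewrite cauchy_cdf /unif_coord -[RHS]atanK; congr tan.
by have /lt0r_neq0 := pi0; move: (pi : R) (atan _) => p t p0; field.
Qed.

Let V_inj (x y : R) : x \in `]0, 1[ -> y \in `]0, 1[ ->
  unif_coord x = unif_coord y -> x = y.
Proof. by move=> xI yI; exact: (unif_inj (uo_unif unif_coord_onto)). Qed.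

Lemma cauchy_quantile z : z \in `]0, 1[ ->
  law_quantile (cauchy_density m g) z = m + g * unif_coord z.
Proof.
move=> zI; pose F := law_cdf (cauchy_density m g); have e : F (m + g * unif_coord z) = z.
  apply: V_inj => //; first exact: cauchy_cdf_oo.
  by rewrite /F unif_coord_cauchy_cdf; field.
have S x : law_supp (cauchy_density m g) x by exact: f_gt0.
have iF : {in law_supp (cauchy_density m g) &, injective F}.
  move=> x y _ _ /(congr1 unif_coord); rewrite /F !unif_coord_cauchy_cdf.
  by move=> /(mulIf (invr_neq0 gn0)) /addIr.
have E : {in law_supp (cauchy_density m g),
    cancel F (law_quantile (cauchy_density m g))} by exact: pinvKV.
by rewrite -{1}e E// inE.
Qed.

(** [unif_coord_cauchy_cdf] makes the two coordinates differ by the affine map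
    [x |-> (x - m) / g], which conjugates [x |-> a * x + b] to the map of the same
    slope on the right. *)
Lemma conj_cauchy (a b : R) :
  conj_law (cauchy_density m g) (fun x => a * x + b) =
  affine_dist unif_coord unif_coord_inv a ((a * m + b - m) / g).
Proof.
apply/funext => z; rewrite /conj_law.
case: (boolP (z \in `]0, 1[)) => zI; last by rewrite affine_dist_out.
have P : preserves [set: R] a ((a * m + b - m) / g) by [].
apply: V_inj; first exact: cauchy_cdf_oo.
  exact: (affine_dist_oo unif_coord_onto).
rewrite (affine_distE unif_coord_onto)// unif_coord_cauchy_cdf (cauchy_quantile zI).
by field.
Qed.

Lemma isotropy_cauchy : isotropy (cst (2 * pi ^+ 2)) =
  [set conj_law (cauchy_density m g) M | M in incr_affine].
Proof.
apply/seteqP; split=> [A /(isotropyP unif_coord_onto)[a [b [a0 _ ->]]]|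
  A [M [a [b [a0 ->]]] <-]].
  exists (fun x => a * x + (m + g * b - a * m)); first by exists a, (m + g * b - a * m).
  by rewrite conj_cauchy; congr (affine_dist _ _ _ _); field.
by rewrite conj_cauchy; exact: (affine_dist_isotropy unif_coord_onto).
Qed.

Lemma conj_cauchy_inj : {in incr_affine &, injective (conj_law (cauchy_density m g))}.
Proof.
move=> M N; rewrite !inE => -[a [b [a0 ->]]] [a' [b' [a'0 ->]]].
rewrite !conj_cauchy => e.
have {}e y : a * y + (a * m + b - m) / g = a' * y + (a' * m + b' - m) / g.
  have yI := uo_oo unif_coord_onto (y := y) I.
  have := congr1 (fun A => unif_coord (A (unif_coord_inv y))) e.
  by rewrite !(affine_distE unif_coord_onto)// (uo_GH unif_coord_onto (y := y) I).
have e0 := e 0; have e1 := e 1.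
have aa : a = a' by lra.
have bb : b = b'.
  move: e0; rewrite aa !mulr0 !add0r => /(mulIf (invr_neq0 gn0)); lra.
by rewrite aa bb.
Qed.

Lemma conj_cauchy_comp M N : incr_affine M -> incr_affine N ->
  conj_law (cauchy_density m g) (M \o N) =
  conj_law (cauchy_density m g) M \o conj_law (cauchy_density m g) N.
Proof.
move=> [a [b [a0 ->]]] [a' [b' [a'0 ->]]].
have -> : (fun x => a * x + b) \o (fun x => a' * x + b') =
    (fun x => (a * a') * x + (a * b' + b)) by apply/funext => x /=; ring.
rewrite !conj_cauchy (affine_dist_comp unif_coord_onto)//.
by congr (affine_dist _ _ _ _); field.
Qed.

End cauchy.

(** * Uniformizers of laws *)

Section laws.
Context {R : realType}.
Notation mu := (@lebesgue_measure R).

Section law.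
Variable f : R -> R.
Hypothesis lf : law2 f.
Let S := law_supp f.
Let F := law_cdf f.
Let Q := law_quantile f.

Let oS : open S := law2_open lf.
Let f_out x : ~ S x -> f x = 0.
Proof.
move=> nS; apply/eqP; rewrite eq_le (law2_ge0 lf) andbT leNgt.
exact/negP.
Qed.

Let f_cont x : S x -> {for x, continuous f}.
Proof.
by have /(Cn_on_le (m := 0) isT)/Cn_on0 := law2_C2 lf; apply.
Qed.

Let f_meas : measurable_fun setT f.
Proof.
have mS : measurable S by exact: measurable_realfun.open_measurable.
have -> : f = f \_ S.
  apply/funext => x; rewrite patchE; case: ifPn => // /negP; rewrite inE.
  exact: f_out.
apply/(measurable_restrictT f mS).
apply: measurable_realfun.open_continuous_measurable_fun => // x.
by rewrite inE => /f_cont.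
Qed.

Let f_int : mu.-integrable setT (EFin \o f).
Proof.
apply/integrableP; split; first exact/measurable_realfun.measurable_EFinP.
have -> : (\int[mu]_x `|(EFin \o f) x| = \int[mu]_x (f x)%:E)%E.
  by apply: eq_integral => x _ /=; rewrite ger0_norm// (law2_ge0 lf).
by rewrite (law2_int1 lf) ltry.
Qed.

Let f_intS (A : set R) : measurable A -> mu.-integrable A (EFin \o f).
Proof. by move=> mA; apply: integrableS f_int. Qed.

Let f_ge0E (x : R) : (0 <= (EFin \o f) x)%E.
Proof. by rewrite lee_fin (law2_ge0 lf). Qed.

Let FE x : (\int[mu]_(t in `]-oo, x]) (f t)%:E = (F x)%:E)%E.
Proof.
rewrite /F /law_cdf /Rintegral fineK//.
by apply: integrable_fin_num => //; exact: f_intS.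
Qed.

Let F_ge0 x : 0 <= F x.
Proof. by apply: Rintegral_ge0 => y _; exact: law2_ge0 lf y. Qed.

Let F_le1 x : F x <= 1.
Proof.
rewrite -lee_fin -FE -(law2_int1 lf); apply: ge0_subset_integral => //.
- exact/measurable_realfun.measurable_EFinP.
- by move=> y _; exact: f_ge0E.
Qed.

Let dF x : S x -> is_derive x 1 F (f x).
Proof.
move=> Sx; have xu : x < x + 1 by rewrite ltrDl.
have mI : measurable `]-oo, x + 1]%classic by exact: measurable_itv.
have [dF <-] := @continuous_FTC1 _ f -oo%O x (x + 1) xu (f_intS mI)
  (ltNyr x) (f_cont Sx).
exact: der_ex.
Qed.

Let F_lt x y : S x -> S y -> x < y -> F x < F y.
Proof.
move=> Sx Sy xy; apply: (@der_pos_lt _ _ _ _ f xy) => z xzy.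
have Sz : S z by exact: (law2_itv lf) Sx Sy _ xzy.
by split; [exact: dF|exact: Sz].
Qed.

Let F_oo x : S x -> F x \in `]0, 1[.
Proof.
move=> Sx; have /nbhs_ballP[e /= e0 Se] : nbhs x S by exact: open_nbhs_nbhs.
have S1 : S (x - e / 2).
  apply: Se; rewrite /ball/= opprB addrC subrK gtr0_norm; lra.
have S2 : S (x + e / 2).
  apply: Se; rewrite /ball/= opprD addNKr normrN gtr0_norm; lra.
rewrite in_itv/=; apply/andP; split.
  by apply: le_lt_trans (F_ge0 (x - e / 2)) (F_lt S1 Sx _); lra.
by apply: lt_le_trans (F_lt Sx S2 _) (F_le1 (x + e / 2)); lra.
Qed.

Let F_le x y : x <= y -> F x <= F y.
Proof.
move=> xy; rewrite -lee_fin -!FE; apply: ge0_subset_integral => //.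
- exact/measurable_realfun.measurable_EFinP/measurable_funTS.
- by move=> t _; exact: f_ge0E.
- by move=> t /=; rewrite !in_itv/= => /le_trans; apply.
Qed.

Let F_top z : z < 1 -> exists x, z < F x.
Proof.
move=> z1; pose E (n : nat) : set R := `]-oo, n%:R]%classic.
have EU : \bigcup_n E n = setT.
  apply/seteqP; split=> // x _; exists (Num.truncn `|x|).+1 => //.
  rewrite /E/= in_itv/= (le_trans (ler_norm x))// ltW//.
  exact: truncnS_gt.
have h : (\int[mu]_(x in E n) (EFin \o f) x @[n --> \oo] -->
    \int[mu]_(x in \bigcup_n E n) (EFin \o f) x)%E.
  apply: ge0_nondecreasing_set_cvg_integral.
  - apply/nondecreasing_seqP => n; rewrite subsetEset => x.
    by rewrite /E/= !in_itv/= => /le_trans; apply; rewrite ler_nat.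
  - by move=> n; exact: measurable_itv.
  - by move=> n; exact/measurable_realfun.measurable_EFinP/measurable_funTS.
  - by move=> n x _; exact: f_ge0E.
move: h; rewrite EU (law2_int1 lf) => /fine_cvg /cvgr_gt /(_ _ z1) [n _ /(_ n (leqnn n))].
by rewrite /= FE; exists n%:R.
Qed.

Let F_compl (x : R) : \int[mu]_(t in `]x, +oo[) f t = 1 - F x.
Proof.
rewrite -(@Rintegral_itvB _ f -oo%O +oo%O x)//.
  by rewrite set_itvE /Rintegral (law2_int1 lf).
by rewrite set_itvE; exact: f_int.
Qed.

Let F_bot z : 0 < z -> exists x, F x < z.
Proof.
move=> z0; pose E (n : nat) : set R := `]- n%:R, +oo[%classic.
have EU : \bigcup_n E n = setT.
  apply/seteqP; split=> // x _; exists (Num.truncn `|x|).+1 => //.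
  rewrite /E/= in_itv/= andbT ltrNl (le_lt_trans (ler_norm (- x)))// normrN.
  exact: truncnS_gt.
have h : (\int[mu]_(x in E n) (EFin \o f) x @[n --> \oo] -->
    \int[mu]_(x in \bigcup_n E n) (EFin \o f) x)%E.
  apply: ge0_nondecreasing_set_cvg_integral.
  - apply/nondecreasing_seqP => n; rewrite subsetEset => x.
    rewrite /E/= !in_itv/= !andbT; apply: le_lt_trans.
    by rewrite lerN2 ler_nat.
  - by move=> n; exact: measurable_itv.
  - by move=> n; exact/measurable_realfun.measurable_EFinP/measurable_funTS.
  - by move=> n x _; exact: f_ge0E.
have z1 : 1 - z < 1 by rewrite ltrBlDr ltrDl.
move: h; rewrite EU (law2_int1 lf) => /fine_cvg /cvgr_gt /(_ _ z1) [n _ /(_ n (leqnn n))].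
rewrite /= -[fine _]/(\int[mu]_(t in `](- n%:R)%R, +oo[) f t) F_compl => h.
by exists (- n%:R); lra.
Qed.

(* Outside of the support, the whole mass lies on one side of [x]. *)
Let F_const x : ~ S x -> F x = 0 \/ F x = 1.
Proof.
move=> nS; have [[y [Sy yx]]|nlt] := pselect (exists y, S y /\ y < x).
  right; apply: EFin_inj; rewrite -FE -(law2_int1 lf) integral_mkcond.
  apply: eq_integral => t _; rewrite patchE; case: ifPn => // /negP tx.
  rewrite f_out// => St; apply: nS; apply: (law2_itv lf) Sy St _ _.
  rewrite (ltW yx)/= leNgt; apply/negP => tx'; apply: tx.
  by rewrite inE/= in_itv/= ltW.
left; apply: EFin_inj; rewrite -FE; apply: integral0_eq => t /=.
rewrite in_itv/= => tx; rewrite f_out// => St; apply: nS.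
have [xt|xt] := leP x t; first by have -> : x = t by apply/eqP; rewrite eq_le xt tx.
by exfalso; apply: nlt; exists t.
Qed.

(* On a large segment the distribution function is continuous and takes values
   below and above [z]; a point where it equals [z] is in the support by
   [F_const]. *)
Let F_surj z : z \in `]0, 1[ -> exists2 x, S x & F x = z.
Proof.
rewrite in_itv/= => /andP[z0 z1].
have [M zM] := F_top z1; have [m mz] := F_bot z0.
have mM : m < M.
  by rewrite ltNge; apply/negP => /F_le; rewrite leNgt (lt_trans mz zM).
pose P x := \int[mu]_(t in `[m, x]) f t.
have PE x : m <= x -> P x = F x - F m.
  move=> mx; have mI : measurable `]-oo, x]%classic by exact: measurable_itv.
  have := @Rintegral_itvB _ f -oo%O (BRight x) m (f_intS mI) isT.
  rewrite bnd_simp => /(_ mx); rewrite -/(F x) -/(F m) => ->.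
  by rewrite Rintegral_itv_obnd_cbnd//; apply: f_intS; exact: measurable_itv.
have cP : {within `[m, M], continuous P}.
  by apply: parameterized_integral_continuous; [exact: ltW|apply: f_intS; exact: measurable_itv].
have [|x] := @IVT _ P m M (z - F m) (ltW mM) cP.
  rewrite !PE ?lexx ?(ltW mM)// subrr ge_min le_max; apply/andP; split.
    by apply/orP; left; lra.
  by apply/orP; right; lra.
rewrite in_itv/= => /andP[mx _]; rewrite PE// => /addIr xz.
exists x => //; apply: contrapT => /F_const[]; rewrite xz => e.
  by move: z0; rewrite e ltxx.
by move: z1; rewrite e ltxx.
Qed.

Let F_inj x y : S x -> S y -> F x = F y -> x = y.
Proof.
move=> Sx Sy e; have [xy|xy|//] := ltgtP x y.
  by have := F_lt Sx Sy xy; rewrite e ltxx.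
by have := F_lt Sy Sx xy; rewrite e ltxx.
Qed.

Let QP z : z \in `]0, 1[ -> S (Q z) /\ F (Q z) = z.
Proof.
move=> zI; have sF : set_surj S `]0, 1[ F by move=> y /F_surj[x Sx <-]; exists x.
split; first by apply: (surjpinv_image_sub (dflt := fun=> 0) sF); exists z.
have E : {in `]0, 1[%classic, cancel Q F} by exact: surjpK.
by apply: E; rewrite inE.
Qed.

Let QF x : S x -> Q (F x) = x.
Proof. by move=> Sx; have [SQ e] := QP (F_oo Sx); exact: F_inj. Qed.

Let dQ (z : R) : z \in `]0, 1[ -> is_derive z 1 Q (f (Q z))^-1.
Proof.
move=> zI; have [SQ _] := QP zI.
apply: (der_inverse oS (@open_oo _ 0 1) (fun y yI => (QP yI).1) F_oo
  (fun y yI => (QP yI).2) QF dF zI).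
exact: lt0r_neq0.
Qed.

Let Q_C3 : Cn_on 3 `]0, 1[ Q.
Proof.
apply: (Cn_on_inverse oS (@open_oo _ 0 1) (fun y yI => (QP yI).1)
  (fun y yI => (QP yI).2)).
- by move=> x Sx; rewrite (der_derive1 (dF Sx)); exact: lt0r_neq0.
- by move=> y yI; case: (dQ yI).
- by apply: (Cn_onS_der oS dF); exact: law2_C2 lf.
Qed.

Let Q_pos (z : R) : z \in `]0, 1[ -> 0 < derive1 Q z.
Proof.
by move=> zI; rewrite (der_derive1 (dQ zI)) invr_gt0; have [] := QP zI.
Qed.

Let Q_near x : S x -> \forall z \near 0^'+, (z \in `]0, 1[) /\ Q z < x.
Proof.
move=> Sx; have := F_oo Sx; rewrite in_itv/= => /andP[F0 F1].
near=> z; have zI : z \in `]0, 1[ by rewrite in_itv/=; apply/andP; split.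
split=> //; have [SQ e] := QP zI.
have zx : z < F x by [].
rewrite ltNge; apply/negP; rewrite le_eqVlt => /orP[/eqP xQ|/(F_lt Sx SQ)].
  by move: zx; rewrite xQ e ltxx.
by rewrite e => /(lt_trans zx); rewrite ltxx.
Unshelve. all: by end_near.
Qed.

Lemma law_uniformizer_unbounded : (forall K, exists2 x, S x & x < K) ->
  uniformizer (law_hill f) Q.
Proof.
move=> Su; split=> // K; have [x Sx xK] := Su K.
by apply: filterS (Q_near Sx) => z [_ /lt_trans]; apply.
Qed.

(** The Moebius map [y |-> - 1 / (y - l)] has Schwarzian derivative zero and
    sends the left endpoint [l] of the support to -oo. *)
Lemma law_uniformizer_bounded (l : R) : (forall x, S x -> l < x) ->
  (forall e, 0 < e -> exists2 x, S x & x < l + e) ->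
  uniformizer (law_hill f) (fun z => - (Q z - l)^-1).
Proof.
move=> lS Sl; have oI := @open_oo R 0 1.
have ql z : z \in `]0, 1[ -> 0 < Q z - l.
  by move=> zI; rewrite subr_gt0; apply: lS; have [] := QP zI.
have qn z : z \in `]0, 1[ -> Q z - l != 0 by move=> /ql/lt0r_neq0.
have dG (z : R) (zI : z \in `]0, 1[) : is_derive z 1 (fun z => - (Q z - l)^-1)
    (derive1 Q z / (Q z - l) ^+ 2).
  have dQz : is_derive z 1 Q (derive1 Q z) by apply: der_ex; case: (dQ zI).
  refine (is_derive_eq (derN (derV (f := fun z => Q z - l) (qn z zI)
    (derB dQz (derC l z)))) _).
  by rewrite subr0 mulNr opprK.
pose L : set R := [set y | l < y].
have oL : open L by exact: open_gt.
pose phi (y : R) := - (y - l)^-1.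
(* powers are written as products, whose derivatives are rational expressions *)
have jphi : jet3 L phi (fun y => ((y - l) * (y - l))^-1)
    (fun y => -2 / ((y - l) * (y - l) * (y - l)))
    (fun y => 6 / ((y - l) * (y - l) * (y - l) * (y - l))).
  move=> y; rewrite /L/= -subr_gt0 => /lt0r_neq0 y0.
  have d1 := derB (derI y) (derC l y).
  split.
  - refine (is_derive_eq (derN (derV (f := fun y => y - l) y0 d1)) _).
    by field.
  - refine (is_derive_eq (derV (f := fun y => (y - l) * (y - l))
      (mulf_neq0 y0 y0) (derM d1 d1)) _).
    by field.
  - refine (is_derive_eq (derM (derC (-2) y)
      (derV (f := fun y => (y - l) * (y - l) * (y - l))
      (mulf_neq0 (mulf_neq0 y0 y0) y0) (derM (derM d1 d1) d1))) _).
    by field.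
split.
- apply: (Cn_onN oI); apply: (Cn_onV oI qn).
  exact: (Cn_onD oI Q_C3 (Cn_on_cst _ _ oI)).
- move=> z zI; rewrite (der_derive1 (dG z zI)) divr_gt0 ?Q_pos//.
  by rewrite exprn_gt0// ql.
- move=> z zI; have Lq : L (Q z) by rewrite /L/= -subr_gt0; exact: ql.
  have q0 := qn z zI; have dphi := jphi _ Lq.
  rewrite (@schwarzian_comp _ `]0, 1[ L phi Q z)//.
  + rewrite (schwarzian_jet3 oL jphi Lq).
    rewrite [X in X * _](_ : _ = 0) ?mul0r ?add0r//.
    by field.
  + by move=> y yI; rewrite /L/= -subr_gt0; exact: ql.
  + exact: jet3_derivable_n jphi.
  + by case: Q_C3.
  + by case: dphi => /der_derive1 -> _ _; rewrite invr_eq0 mulf_neq0.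
  + by rewrite lt0r_neq0// Q_pos.
- move=> K; have k0 : 0 < `|K| + 1 by rewrite ltr_wpDl.
  have [|x Sx xl] := Sl (`|K| + 1)^-1; first by rewrite invr_gt0.
  apply: filterS (Q_near Sx) => z [zI zx].
  have h : Q z - l < (`|K| + 1)^-1 by lra.
  rewrite ltrNl; apply: (@lt_le_trans _ _ (`|K| + 1)).
    by rewrite (le_lt_trans (ler_norm (- K)))// normrN ltrDl.
  by rewrite -[leLHS]invrK lef_pV2 ?posrE ?invr_gt0 ?ql// ltW.
Qed.

Lemma law_uniformizer : exists G, uniformizer (law_hill f) G.
Proof.
have [Su|nb] := pselect (forall K, exists2 x, S x & x < K).
  by exists Q; exact: law_uniformizer_unbounded.
have [K Kb] : exists K, forall x, S x -> K <= x.
  apply: contrapT => nK; apply: nb => K; apply: contrapT => nx; apply: nK.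
  by exists K => x Sx; rewrite leNgt; apply/negP => xK; apply: nx; exists x.
have hI : has_inf S.
  split; last by exists K.
  have hz : 2^-1 \in `]0, (1 : R)[ by rewrite in_itv/=; apply/andP; split; lra.
  by exists (Q 2^-1); have [] := QP hz.
exists (fun z => - (Q z - inf S)^-1); apply: law_uniformizer_bounded; last first.
  by move=> e e0; have [x Sx xe] := inf_adherent e0 hI; exists x.
move=> x Sx; rewrite lt_neqAle; apply/andP; split; last exact: ge_inf hI.2 _ Sx.
apply/eqP => xE; have /nbhs_ballP[e /= e0 Se] : nbhs x S by exact: open_nbhs_nbhs.
have S1 : S (x - e / 2).
  apply: Se; rewrite /ball/= opprB addrC subrK gtr0_norm; lra.
by have := ge_inf hI.2 S1; rewrite xE; lra.
Qed.

End law.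

End laws.

Theorem theorem22 (R : realType) :
  let Uc : R -> R := cst (2 * pi ^+ 2) in
  let xi_can : R -> R := drift canonical_kernel in
  let xi_quarter : R -> R := drift quarter_kernel in
  let V : R -> R := unif_coord in
  (* dimensions along the constant potentials of the cone *)
  (forall c : R, prob_cone (cst c) -> c != 2 * pi ^+ 2 ->
     has_lie_dim (isotropy (cst c)) 1) /\
  (prob_cone Uc /\ has_lie_dim (isotropy Uc) 2) /\
  (* the formal isotropy algebra at the threshold *)
  (formal_isotropy Uc =
     [set xi | [/\ derivable_n 3 `]0, 1[ xi,
         forall z, z \in `]0, 1[ -> derive1n 3 xi z + 4 * pi ^+ 2 * derive1 xi z = 0
       & vanish_ends xi]]) /\
  (formal_isotropy Uc =
     field_span (fun z => sin (2 * pi * z) / (2 * pi))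
                (fun z => (1 - cos (2 * pi * z)) / (2 * pi))) /\
  (formal_isotropy Uc = field_span xi_can xi_quarter) /\
  (* both fields are complete and the whole algebra integrates *)
  (complete_field xi_can /\ complete_field xi_quarter) /\
  (forall xi : R -> R, formal_isotropy Uc xi ->
     exists2 phi : R -> R -> R, is_flow xi phi & forall t, isotropy Uc (phi t)) /\
  (* the two flows in the uniformizing coordinate *)
  (forall phi : R -> R -> R, is_flow xi_can phi ->
     forall t z : R, z \in `]0, 1[ ->
       is_derive t (1 : R) (fun s => V (phi s z)) (V (phi t z)) /\
       V (phi t z) = expR t * V z) /\
  (forall phi : R -> R -> R, is_flow xi_quarter phi ->
     forall t z : R, z \in `]0, 1[ ->
       is_derive t (1 : R) (fun s => V (phi s z)) 1 /\
       V (phi t z) = V z + t) /\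
  (* the isotropy group is the increasing affine group, conjugated by any
     Cauchy law *)
  (forall m g : R, 0 < g ->
     let C := conj_law (cauchy_density m g) in
     [/\ isotropy Uc = [set C M | M in incr_affine],
         {in incr_affine &, injective C}
       & forall M N, incr_affine M -> incr_affine N -> C (M \o N) = C M \o C N]) /\
  (* no isotropy group of dimension three or more *)
  (forall (f : R -> R) (d : nat), law2 f -> (3 <= d)%N ->
     ~ has_lie_dim (isotropy (law_hill f)) d).

Proof.
split; first by move=> c /prob_cone_cst_le cle cne; apply: lie_dim_subcritical;
  rewrite lt_neqAle cne.
split; first by split; [exact: prob_cone_critical|exact: lie_dim_setT unif_coord_onto].
split; first exact: critical_formalE.
split; first exact: critical_formal_span.
split; first exact: critical_drift_span.
split; first by split; [exact: canonical_complete|exact: quarter_complete].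
split; first exact: critical_integrates.
split; first by move=> phi fl t z zI; exact: canonical_flow_unif.
split; first by move=> phi fl t z zI; exact: quarter_flow_unif.
split.
  move=> m g g0; split; first exact: isotropy_cauchy.
    exact: conj_cauchy_inj.
  exact: conj_cauchy_comp.
move=> f d lf d3; have [G uG] := law_uniformizer lf.
exact: no_lie_dim3 uG d3.
Qed.
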